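(* There exists a unique value function $u_\varepsilon:=u^\varepsilon_{\mathrm I}=u^\varepsilon_{\mathrm{II}}$ in $\Omega_\varepsilon=\Omega\cup\Gamma_\varepsilon$ (i.e. the values of the random step size tug-of-war with noise for Player I and for Player II coincide), satisfying $u_\varepsilon=F$ on $\Gamma_\varepsilon$. Moreover $u_\varepsilon$ satisfies, for every $x\in\Omega$, the dynamic programming principle $$u_\varepsilon(x)=\frac{\alpha}{2\varepsilon}\int_0^\varepsilon\Big(\sup_{B_t(x)}u_\varepsilon+\inf_{B_t(x)}u_\varepsilon\Big)\,dt+\beta\,\frac{1}{|B_\varepsilon(x)|}\int_{B_\varepsilon(x)}u_\varepsilon(z)\,dz.$$
   Context: Standing setting: $n\ge 2$, $2<p<\infty$, $\varepsilon\in(0,1)$, and $\Omega\subset\mathbb R^n$ is a bounded domain satisfying the uniform exterior sphere condition (there is $\rho>0$ such that every $y\in\partial\Omega$ lies on $\partial B_\rho(z)$ for some ball $B_\rho(z)\subset\mathbb R^n\setminus\Omega$). $B_t(x)$ is the open ball of radius $t$ centered at $x$. Set $\Gamma_\varepsilon=\{x\in\mathbb R^n\setminus\Omega:\operatorname{dist}(x,\partial\Omega)\le\varepsilon\}$, $\Omega_\varepsilon=\Omega\cup\Gamma_\varepsilon$, $\alpha=\frac{p-2}{p+n}$, $\beta=\frac{n+2}{p+n}=1-\alpha$. The payoff (boundary values) $F:\Gamma_\varepsilon\to\mathbb R$ is bounded and Borel measurable. The game (random step size tug-of-war with noise): a token starts at $x_0$. If the token is at $x_k\in\Omega$, then with probability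 $\beta$ (outcome $c_{k+1}=0$) it moves to $x_{k+1}$ uniformly distributed in $B_\varepsilon(x_k)$; with probability $\alpha$ a step size $\varepsilon_{k+1}$ is chosen uniformly on $[0,\varepsilon]$, a fair coin is tossed, and the winner (Player I if $c_{k+1}=1$, Player II if $c_{k+1}=2$) moves the token to any chosen point $x_{k+1}\in B_{\varepsilon_{k+1}}(x_k)$. The game stops at the first time $\tau$ with $x_\tau\in\Gamma_\varepsilon$, and Player II pays Player I the amount $F(x_\tau)$. A strategy $S_{\mathrm I}$ (resp. $S_{\mathrm{II}}$) of Player I (resp. II) is a collection of measurable functions giving the next position $x_{k+1}\in B_{\varepsilon_{k+1}}(x_k)$ as a function of the history $(x_0,(c_1,\varepsilon_1,x_1),\dots,(c_k,\varepsilon_k,x_k))$ and the next step size $\varepsilon_{k+1}$, used when that player wins the toss. A starting point $x_0$ and strategies $S_{\mathrm I},S_{\mathrm{II}}$ determine a probability measure on game trajectories, with expectation $\mathbb E^{x_0}_{S_{\mathrm I},S_{\mathrm{II}}}$; the game ends almost surely. The values are $u^\varepsilon_{\mathrm I}(x_0)=\sup_{S_{\mathrm I}}\inf_{S_{\mathrm{II}}}\mathbb E^{x_0}_{S_{\mathrm I},S_{\mathrm{II}}}[F(x_\tau)]$ for Player I and $u^\varepsilon_{\mathrm{II}}(x_0)=\inf_{S_{\mathrm{II}}}\sup_{S_{\mathrm I}}\mathbb E^{x_0}_{S_{\mathrm I},S_{\mathrm{II}}}[F(x_\tau)]$ for Player II (for $x_0\in\Gamma_\varepsilon$ the game stops immediately,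 $\tau=0$). *)

(* Defs.v *)
From HB Require Import structures.
From mathcomp Require Import all_boot all_order all_algebra.
From mathcomp Require Import all_classical all_reals all_analysis.
From mathcomp Require Import measurable_realfun.

Set Implicit Arguments.
Unset Strict Implicit.
Unset Printing Implicit Defensive.

Import Order.TTheory GRing.Theory Num.Theory.
Import numFieldNormedType.Exports.

Local Open Scope classical_set_scope.
Local Open Scope ring_scope.

(* The library has the topology of matrices but no measurable structure on
   them: 'M[R]_(m, n), in particular 'rV[R]_n, gets its Borel sigma-algebra. *)
Section borel_matrix.
Context (R : realType) (m n : nat).
Local Notation G := (@open 'M[R]_(m, n)).

HB.instance Definition _ := @isMeasurable.Build (sigma_display G)
  'M[R]_(m, n) <<s G >> (@sigma_algebra0 _ setT G) (@sigma_algebraC _ G)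
  (@sigma_algebra_bigcup _ setT G).

End borel_matrix.

Section image_measure.
Context d d' (T : measurableType d) (T' : measurableType d') (R : realType).
Variables (mu : {measure set T -> \bar R}) (f : T -> T').
Hypothesis mf : measurable_fun setT f.

(* [pushforward mu f], with the measurability proof as an argument so that the
   measure structure can be inferred. *)
Definition image_measure of measurable_fun setT f := pushforward mu f.
Local Notation nu := (image_measure mf).

Let nu0 : nu set0 = 0%E.
Proof. by rewrite /image_measure /pushforward preimage_set0 measure0. Qed.

Let nu_ge0 A : (0 <= nu A)%E.
Proof. exact: measure_ge0. Qed.

Let nu_sigma_additive : semi_sigma_additive nu.
Proof.
move=> F mF tF mUF; rewrite /image_measure /pushforward preimage_bigcup.
apply: measure_semi_sigma_additive.
- by move=> n; rewrite -[X in measurable X]setTI; exact: mf.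
- apply/trivIsetP => /= i j _ _ ij; rewrite -preimage_setI.
  by move/trivIsetP : tF => /(_ _ _ _ _ ij) ->//; rewrite preimage_set0.
- by rewrite -preimage_bigcup -[X in measurable X]setTI; exact: mf.
Qed.

HB.instance Definition _ := isMeasure.Build _ _ _ nu
  nu0 nu_ge0 nu_sigma_additive.

End image_measure.

Section lebesgue.
Context (R : realType).
Local Notation borelR := (measurableTypeR R).

Definition tcons k (z : borelR * k.-tuple borelR) : k.+1.-tuple borelR :=
  [tuple of z.1 :: z.2].

Lemma measurable_tcons k : measurable_fun setT (@tcons k).
Proof. exact: measurable_cons. Qed.

(* Lebesgue measure as the iterated product of the one on R. *)
Fixpoint lebesgue_tuple k : {measure set (k.-tuple borelR) -> \bar R} :=
  if k is k'.+1 then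
    image_measure (lebesgue_measure \x^ lebesgue_tuple k')%E
      (@measurable_tcons k')
  else \d_[tuple].

Definition row_of_tuple k (t : k.-tuple borelR) : 'rV[R]_k :=
  \row_i tnth t i.

Lemma measurable_row_of_tuple k : measurable_fun setT (@row_of_tuple k).
Proof.
apply: (@measurability _ _ _ _ setT _ (@open 'rV[R]_k)) => // _ [U oU <-].
rewrite setTI.
pose box (c : k.-tuple rat * rat) : set 'rV[R]_k :=
  [set v | forall i, `|ratr (tnth c.1 i) - v ord0 i| < ratr c.2].
have -> : @row_of_tuple k @^-1` U =
  \bigcup_c [set t | box c `<=` U /\ box c (row_of_tuple t)].
  apply/seteqP; split=> [t Ut|t [c _ []]]; last exact.
  have : nbhs (row_of_tuple t) U by exact: open_nbhs_nbhs.
  move=> /nbhs_ballP[e /= e0 eU].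
  have [q [q0 qe]] : exists q : rat, 0 < ratr q :> R /\ ratr q < e / 2.
    have [|q] := @rat_in_itvoo R 0 (e/2); first by rewrite divr_gt0.
    by rewrite in_itv /= => /andP[]; exists q.
  have /choice[c cP] : forall i, exists a : rat, `|ratr a - tnth t i| < ratr q.
    move=> i.
    have [|a] := @rat_in_itvoo R (tnth t i - ratr q) (tnth t i + ratr q).
      by rewrite ltrD2l gtrN.
    by rewrite in_itv /= -ltr_distl => ?; exists a.
  exists ([tuple c i | i < k], q) => //; split=> [v /= bv|i].
    2: by rewrite /= tnth_mktuple mxE.
  apply: eU; split => // i j; rewrite !mxE /ball /= ord1.
  have := bv j; have := cP j; rewrite tnth_mktuple => h1 h2.
  rewrite -(subrKA (ratr (c j))) (le_lt_trans (ler_normD _ _))//.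
  by rewrite (splitr e) ltrD// ?(lt_trans _ qe)// distrC.
apply: countable_bigcupT_measurable => // c.
have [cU|cU] := pselect (box c `<=` U); last first.
  rewrite (_ : [set _ | _] = set0)//; apply/seteqP; by split => // ? [].
rewrite (_ : [set _ | _] = \bigcap_(i in [set: 'I_k])
  (fun t => tnth t i) @^-1`
    [set x : borelR | `|ratr (tnth c.1 i) - x| < ratr c.2]).
  apply: fin_bigcap_measurable => // i _.
  rewrite -[X in measurable X]setTI; apply: measurable_tnth => //.
  exact: (measurable_ball (ratr (tnth c.1 i) : R)).
apply/seteqP; split => [t [_ +] i _ /=|t h]; first by move/(_ i); rewrite mxE.
by split => // i; rewrite mxE; exact: h.
Qed.

Definition lebesgue_rV k : {measure set 'rV[R]_k -> \bar R} :=
  image_measure (lebesgue_tuple k)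
    (@measurable_row_of_tuple k).

End lebesgue.

Section euclidean.
Context (R : realType) (n : nat).
Implicit Types (x y : 'rV[R]_n) (A : set 'rV[R]_n).

(* The library norm and balls of 'rV[R]_n are those of the maximum norm;
   topology, boundedness and connectedness do not depend on this choice. *)
Definition enorm x : R := Num.sqrt (\sum_i x ord0 i ^+ 2).

Definition eball x (t : R) : set 'rV[R]_n := [set y | enorm (y - x) < t].

Definition boundary A : set 'rV[R]_n := closure A `\` A^°.

Definition edist_set x A : R := inf [set enorm (x - y) | y in A].

Definition bounded_domain A : Prop :=
  [/\ A !=set0, open A, connected A & bounded_set A].

Definition uniform_exterior_sphere A : Prop :=
  exists2 rho : R, 0 < rho &
    forall y, boundary A y ->
      exists z, eball z rho `<=` ~` A /\ enorm (y - z) = rho.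

End euclidean.

(* The uniform probability on a set [B] with [0 < mu B < +oo]. *)
Definition uniform_on d (T : measurableType d) (R : realType)
    (mu : {measure set T -> \bar R}) (B A : set T) : \bar R :=
  (((fine (mu B))^-1)%:E * mu (A `&` B))%E.

Section game.
Context (R : realType) (n : nat).
Variables (p eps : R) (Omega : set 'rV[R]_n) (F : 'rV[R]_n -> R).

Definition alpha : R := (p - 2) / (p + n%:R).
Definition beta : R := (n%:R + 2) / (p + n%:R).

Definition Gamma_eps : set 'rV[R]_n :=
  [set x | ~ Omega x /\ edist_set x (boundary Omega) <= eps].

Definition Omega_eps : set 'rV[R]_n := Omega `|` Gamma_eps.

(* One round (c, t, x): outcome c, step size t, new position x.  Outcomes are
   0 for the noise, 1 and 2 for the player who wins the toss; in a noise round
   no step size is drawn and the constant eps is recorded in its place. *)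
Definition round : Type := (nat * (R * 'rV[R]_n))%type.

HB.instance Definition _ := Measurable.on round.

(* History (x_0, (c_1, eps_1, x_1), ..., (c_k, eps_k, x_k)). *)
Definition history (k : nat) : Type := ('rV[R]_n * k.-tuple round)%type.

HB.instance Definition _ k := Measurable.on (history k).

Definition position k (h : history k) : 'rV[R]_n :=
  last h.1 [seq r.2.2 | r <- h.2].

(* B_0(x) being empty, the constraint on the moves bears on positive step
   sizes only; the step size 0 has probability 0. *)
Record strategy := Strategy {
  next_position :> forall k, history k * R -> 'rV[R]_n ;
  measurable_next_position : forall k, measurable_fun setT (@next_position k) ;
  next_position_eball : forall k (h : history k) t, 0 < t <= eps ->
    eball (position h) t (next_position (h, t)) }.

(* The conditional law of round k+1 given the history up to round k; once the
   game has stopped, the token stays where it is. *)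
Definition round_law (S1 S2 : strategy) k (h : history k) (A : set round)
    : \bar R :=
  let x := position h in
  if `[< Omega x >] then
    (beta%:E * uniform_on (lebesgue_rV R n) (eball x eps)
                 [set z | A (0%N, (eps, z))]
     + (alpha / 2)%:E * uniform_on (@lebesgue_measure R) `[0%R, eps]
                 [set t | A (1%N, (t, S1 k (h, t)))]
     + (alpha / 2)%:E * uniform_on (@lebesgue_measure R) `[0%R, eps]
                 [set t | A (2%N, (t, S2 k (h, t)))])%E
  else \d_(0%N, (eps, x)) A.

Definition first_rounds k (w : nat -> round) : k.-tuple round :=
  [tuple w i | i < k].

Definition cylinders : set (set (nat -> round)) :=
  [set C | exists k (B : set (k.-tuple round)),
     measurable B /\ C = @first_rounds k @^-1` B].

(* Trajectories (c_1, eps_1, x_1), (c_2, eps_2, x_2), ... of the game, with the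
   product sigma-algebra. *)
Definition trajectory : Type := g_sigma_algebraType cylinders.

HB.instance Definition _ := Measurable.on trajectory.

Definition is_game_law (x0 : 'rV[R]_n) (S1 S2 : strategy)
    (P : probability trajectory R) : Prop :=
  forall k (B : set (k.-tuple round)) (A : set round),
    measurable B -> measurable A ->
    P [set w : trajectory | B (first_rounds k w) /\ A (w k)] =
    (\int[P]_(w in [set w : trajectory | B (first_rounds k w)])
      round_law S1 S2 (x0, first_rounds k w) A)%E.

(* The measure satisfying [is_game_law x0 S1 S2]: it exists by the theorem of
   Ionescu-Tulcea, and two such measures agree on measurable sets since
   cylinders form a pi-system. *)
Definition game_law (x0 : 'rV[R]_n) (S1 S2 : strategy)
    : probability trajectory R :=
  xget (\d_(point : trajectory) : probability trajectory R)
    (is_game_law x0 S1 S2).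

Definition state (x0 : 'rV[R]_n) (w : trajectory) (k : nat) : 'rV[R]_n :=
  position (x0, first_rounds k w).

(* tau, with the dummy value 0 on trajectories which never reach Gamma_eps *)
Definition tau (x0 : 'rV[R]_n) (w : trajectory) : nat :=
  xget 0%N [set k | Gamma_eps (state x0 w k) /\
                    forall j, (j < k)%N -> ~ Gamma_eps (state x0 w j)].

(* F is only meaningful on Gamma_eps: [F \_ Gamma_eps] vanishes elsewhere. *)
Definition payoff (x0 : 'rV[R]_n) (w : trajectory) : R :=
  (F \_ Gamma_eps) (state x0 w (tau x0 w)).

Definition expected_payoff (x0 : 'rV[R]_n) (S1 S2 : strategy) : \bar R :=
  ('E_(game_law x0 S1 S2)[payoff x0])%E.

Definition value_I (x0 : 'rV[R]_n) : \bar R :=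
  ereal_sup (range (fun S1 =>
    ereal_inf (range (fun S2 => expected_payoff x0 S1 S2)))).

Definition value_II (x0 : 'rV[R]_n) : \bar R :=
  ereal_inf (range (fun S2 =>
    ereal_sup (range (fun S1 => expected_payoff x0 S1 S2)))).

Definition dpp (u : 'rV[R]_n -> R) (x : 'rV[R]_n) : Prop :=
  u x = alpha / (2 * eps) *
          \int[@lebesgue_measure R]_(t in `[0, eps])
            (sup (u @` eball x t) + inf (u @` eball x t))
        + beta * ((fine (lebesgue_rV R n (eball x eps)))^-1 *
            \int[lebesgue_rV R n]_(z in eball x eps) u z).

End game.

(* Main.v *)
(* Since [Omega] is bounded, there is a bounded function [V] of the first
   coordinate, exponential on [Omega], whose mean over [B_eps(x)] times [beta]
   exceeds [V x + c] for some [c > 0] and all [x] in [Omega].  The dynamic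
   programming operator, although not a contraction for the sup norm, is one
   for the norm weighted by [2 C - V], where [C] bounds [V].  Its iterates from
   a constant therefore converge uniformly, and monotonically, to a fixed point
   [u]; as suprema of arbitrary functions over open balls are Borel functions
   of the center and of the radius, [u] is Borel measurable.

   Along the game, whose law exists by the theorem of Ionescu-Tulcea, the mean
   of [V] at the position of the token increases by at least [c] times the
   probability of not having stopped, so that the game ends almost surely.  If
   Player I always moves to a point where [u] is within [d 2^-(k+1)] of its
   supremum, which can be done measurably with points of a countable set, then
   the mean of [u] at the position of the token decreases by at most [d] in
   total, whatever Player II does; by dominated convergence the expected payoff
   is at least [u x0 - d].  The bound for Player II is symmetric, and
   [value_I <= value_II] always holds. *)

From HB Require Import structures.
Require Import Defs.
From mathcomp Require Import all_boot all_order all_algebra.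
From mathcomp Require Import all_classical all_reals all_analysis.
From mathcomp Require Import measurable_realfun.
From mathcomp Require Import lra ring.

Set Implicit Arguments.
Unset Strict Implicit.
Unset Printing Implicit Defensive.
Set SsrOldRewriteGoalsOrder.

Import Order.TTheory GRing.Theory Num.Theory.
Import numFieldNormedType.Exports.

Local Open Scope classical_set_scope.
Local Open Scope ring_scope.

(** * Mixtures of measures and the Ionescu-Tulcea theorem *)

(** The obstacle to a plain fixed point argument is that the players may undo any progress: their
    moves are estimated by nothing better than the extreme values of the weight, so the whole gain
    has to come from the noise. The weight [2 C - V] lies between [C] and [2 C]. Being positive, it
    gives a norm equivalent to the sup norm; being at most [2 C], it contains the gain [c] as a
    fraction at least [c / (2 C)], whence the contraction factor [1 - c / (2 C)]. Monotone
    convergence of the iterates alone would not do, since infima over balls do not commute with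
    increasing limits. On the side of the game, [game_law] is known only through the identity
    [is_game_law] on events [B x A]. Taken with [B] the whole space, it makes the law of a round a
    mixture of the conditional laws; this gives one-step inequalities between means of functions of
    the position, which do the work of martingales. Functions live on the whole space, the payoff
    being extended by 0 outside [Gamma_eps]; almost surely the token does not see these values,
    since a move from [Omega] cannot leave [Omega_eps]. *)

Section mixture.
Context d d' (Y : measurableType d) (Z : measurableType d') (R : realType).
Local Open Scope ereal_scope.
Import HBNNSimple.

(** By linearity the identity passes from sets to simple functions, then by monotone convergence on
    both sides to nonnegative functions. The measure [m] is arbitrary subject to [mE], so that the
    lemma also applies to marginals of the game law. *)
Lemma integral_mixture (P : {measure set Y -> \bar R})
    (k : Y -> {measure set Z -> \bar R})
    (mk : forall U, measurable U -> measurable_fun setT (k ^~ U))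
    (m : {measure set Z -> \bar R})
    (mE : forall A, measurable A -> m A = \int[P]_y k y A)
    (f : Z -> \bar R) :
  (forall z, 0 <= f z) -> measurable_fun setT f ->
  \int[m]_z f z = \int[P]_y \int[k y]_z f z.
Proof.
move=> f0 mf.
pose g := nnsfun_approx measurableT mf.
have mg n : measurable_fun setT (EFin \o g n) by exact/measurable_EFinP.
have g0 n z : 0 <= (g n z)%:E by rewrite lee_fin.
have ndg z : {homo (fun n => (g n z)%:E) : a b / (a <= b)%N >-> a <= b}.
  by move=> a b ab; rewrite lee_fin; exact/lefP/nd_nnsfun_approx.
have limg (nu : {measure set Z -> \bar R}) :
    \int[nu]_z f z = limn (fun n => \int[nu]_z (g n z)%:E).
  rewrite -monotone_convergence//.
  by apply: eq_integral => z _; apply/esym/cvg_lim => //;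
    exact: cvg_nnsfun_approx.
rewrite limg; under [RHS]eq_integral do rewrite limg.
rewrite monotone_convergence//; last 3 first.
- by move=> n; apply: (measurable_fun_integral_kernel mk _ (mg n)) => z;
    exact: g0.
- by move=> n y _; exact: integral_ge0.
- by move=> y _ a b ab; apply: ge0_le_integral => //;
    [exact: mg|exact: mg|by move=> z _; exact: ndg].
apply: congr_lim; apply/funext => n.
rewrite integralT_nnsfun sintegralE.
under [RHS]eq_integral do rewrite integralT_nnsfun sintegralE.
rewrite ge0_integral_fsum//.
- apply: eq_fsbigr => r _; rewrite mE//.
  have [r0|r0] := leP 0%R r.
    by rewrite ge0_integralZl//; exact: mk.
  rewrite preimage_nnfun0//.
  under eq_integral do rewrite measure0.
  under [RHS]eq_integral do rewrite measure0 mule0.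
  by rewrite integral0 mule0.
- by move=> r; apply: measurable_funeM; exact: mk.
- by move=> r y _; exact: nnsfun_mulemu_ge0.
Qed.

End mixture.

Section mixture_measure.
Context d d' (Y : measurableType d) (Z : measurableType d') (R : realType).
Variables (P : {measure set Y -> \bar R}) (k : R.-ker Y ~> Z).
Local Open Scope ereal_scope.

Definition mixture (A : set Z) : \bar R := \int[P]_y k y A.

Let mixture0 : mixture set0 = 0.
Proof. by rewrite /mixture; under eq_integral do rewrite measure0;
  rewrite integral0. Qed.

Let mixture_ge0 A : 0 <= mixture A.
Proof. exact: integral_ge0. Qed.

Let mixture_sigma_additive : semi_sigma_additive mixture.
Proof.
move=> F mF tF mUF; rewrite /mixture.
rewrite (_ : \int[P]_y k y _ = \sum_(0 <= i <oo) \int[P]_y k y (F i)).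
  by apply: is_cvg_nneseries => n _ _; exact: integral_ge0.
rewrite -integral_nneseries//.
  apply: eq_integral => y _; apply/esym/cvg_lim => //.
  exact: measure_semi_sigma_additive.
by move=> n; exact: measurable_kernel.
Qed.

HB.instance Definition _ := isMeasure.Build _ _ _ mixture
  mixture0 mixture_ge0 mixture_sigma_additive.

End mixture_measure.

(** * The Ionescu-Tulcea theorem: coordinates drawn successively from kernels *)

Section ionescu_tulcea.
Context d (X : measurableType d) (R : realType).
Variable K : forall k, R.-pker (k.-tuple X) ~> X.

Definition initial k (w : nat -> X) : k.-tuple X := [tuple w i | i < k].

Definition cylinder_sets : set (set (nat -> X)) :=
  [set C | exists k (B : set (k.-tuple X)),
     measurable B /\ C = @initial k @^-1` B].

Local Notation T := (g_sigma_algebraType cylinder_sets).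

Definition update (w : nat -> X) k (r : X) : nat -> X :=
  fun i => if i == k then r else w i.

(** Dependence on the first [k] coordinates, stated on whole sequences: all functions then keep one
    domain, and none has to be factored through tuples. *)
Definition determined U k (f : (nat -> X) -> U) := forall w w' : nat -> X,
  (forall i, (i < k)%N -> w i = w' i) -> f w = f w'.

Lemma determined_initial k : determined k (@initial k).
Proof.
by move=> w w' ww'; apply: eq_from_tnth => i; rewrite !tnth_mktuple ww'.
Qed.

Lemma determinedW U k m (f : (nat -> X) -> U) :
  (k <= m)%N -> determined k f -> determined m f.
Proof. by move=> km fk w w' ww'; apply: fk => i ik;
  apply/ww'/(leq_trans ik). Qed.

Lemma determined_update U k (f : (nat -> X) -> U) w r :
  determined k f -> f (update w k r) = f w.
Proof. by move=> fk; apply: fk => i ik; rewrite /update ltn_eqF. Qed.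

Lemma determined_cylinder k (B : set (k.-tuple X)) :
  determined k (fun w => (\1_(@initial k @^-1` B) w)%:E : \bar R).
Proof.
move=> w w' ww'; rewrite !indicE; congr ((nat_of_bool _)%:R%:E).
by apply/idP/idP => /[!inE]/=; rewrite (determined_initial ww').
Qed.

Lemma cylinder_sets_determined C : cylinder_sets C ->
  exists N, determined N (fun w => (\1_C w)%:E : \bar R).
Proof. by move=> [k [B [_ ->]]]; exists k; exact: determined_cylinder. Qed.

Lemma measurable_initial k : measurable_fun setT (@initial k : T -> _).
Proof.
move=> _ B mB; rewrite setTI; apply: sub_sigma_algebra; by exists k, B.
Qed.

Lemma measurable_coordinate i : measurable_fun setT ((fun w => w i) : T -> X).
Proof.
rewrite (_ : (fun w => w i) = (fun t => tnth t ord_max) \o @initial i.+1).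
  by apply: measurableT_comp; [exact: measurable_tnth|
    exact: measurable_initial].
by apply/funext => w /=; rewrite tnth_mktuple.
Qed.

(** The cylinders generate, and each of them constrains finitely many coordinates. *)
Lemma measurable_to_sequences d' (Y : measurableType d') (f : Y -> T) :
  (forall i, measurable_fun setT (fun y => f y i)) -> measurable_fun setT f.
Proof.
move=> mf; apply: (@measurability _ _ _ _ setT f cylinder_sets) => //.
move=> _ [_ [k [B [mB ->]]] <-]; rewrite setTI.
rewrite -[X in measurable X]setTI.
suff : measurable_fun setT (@initial k \o f) by exact.
apply/measurable_fun_tnthP => i.
rewrite (_ : _ \o _ = fun y => f y i)//.
by apply/funext => y /=; rewrite tnth_mktuple.
Qed.

Lemma measurable_update k :
  measurable_fun setT (fun z : T * X => update z.1 k z.2 : T).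
Proof.
apply: measurable_to_sequences => i; rewrite /update.
case: (i == k); first exact: measurable_snd.
exact: (measurableT_comp (measurable_coordinate i) measurable_fst).
Qed.

Lemma measurable_updater w k :
  measurable_fun setT (update w k : X -> T).
Proof.
apply: measurable_to_sequences => i; rewrite /update.
by case: (i == k).
Qed.

(** Brings two cylinders to a common number of coordinates, which makes their union a cylinder. *)
Lemma cylinder_setsW k m (B : set (k.-tuple X)) : (k <= m)%N ->
  measurable B -> exists B' : set (m.-tuple X),
    measurable B' /\ @initial k @^-1` B = @initial m @^-1` B'.
Proof.
move=> km mB.
exists ((fun t => [tuple tnth t (widen_ord km i) | i < k]) @^-1` B); split.
  rewrite -[X in measurable X]setTI.
  suff : measurable_fun setT
      (fun t : m.-tuple X => [tuple tnth t (widen_ord km i) | i < k]) by exact.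
  apply/measurable_fun_tnthP => i.
  rewrite (_ : _ \o _ = fun t : m.-tuple X => tnth t (widen_ord km i)).
    exact: measurable_tnth.
  by apply/funext => t /=; rewrite tnth_mktuple.
rewrite -comp_preimage; congr (_ @^-1` B); apply/funext => w /=.
by apply: eq_from_tnth => i; rewrite !tnth_mktuple.
Qed.

Lemma cylinder_sets0 : cylinder_sets set0.
Proof. by exists 0%N, set0; rewrite preimage_set0. Qed.

Lemma cylinder_setsC : setC_closed cylinder_sets.
Proof.
move=> _ [k [B [mB ->]]]; exists k, (~` B).
by split; [exact: measurableC|rewrite preimage_setC].
Qed.

Lemma cylinder_setsU : setU_closed cylinder_sets.
Proof.
move=> _ _ [k [B [mB ->]]] [m [B' [mB' ->]]].
have [B1 [mB1 ->]] := cylinder_setsW (leq_maxl k m) mB.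
have [B2 [mB2 ->]] := cylinder_setsW (leq_maxr k m) mB'.
exists (maxn k m), (B1 `|` B2).
by split; [exact: measurableU|rewrite preimage_setU].
Qed.

Local Open Scope ereal_scope.

(* The conditional expectation of [f] given the first [k] coordinates, if [f]
   is determined by the first [k.+1] ones. *)
Definition draw k (f : (nat -> X) -> \bar R) (w : nat -> X) : \bar R :=
  \int[K k (initial k w)]_r f (update w k r).

Lemma determined_draw k f : determined k.+1 f -> determined k (draw k f).
Proof.
move=> fk w w' ww'; rewrite /draw (determined_initial ww').
apply: eq_integral => r _; apply: fk => i; rewrite ltnS leq_eqVlt /update.
by case: eqP => //= _ /ww'.
Qed.

Lemma draw_id k f : determined k f -> draw k f = f.
Proof.
move=> fk; apply/funext => w; rewrite /draw.
under eq_integral do rewrite (determined_update _ _ fk).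
by rewrite integral_cst//= prob_kernel mule1.
Qed.

Lemma draw_ge0 k (f : T -> \bar R) :
  (forall w, 0 <= f w) -> forall w, 0 <= draw k f w.
Proof. by move=> f0 w; exact: integral_ge0. Qed.

Lemma draw_le k (f g : T -> \bar R) :
  measurable_fun setT f -> measurable_fun setT g ->
  (forall w, 0 <= f w) -> (forall w, f w <= g w) ->
  forall w, draw k f w <= draw k g w.
Proof.
move=> mf mg f0 fg w; apply: ge0_le_integral => //.
- by apply: (measurableT_comp mf); exact: measurable_updater.
- by apply: (measurableT_comp mg); exact: measurable_updater.
Qed.

Lemma draw_le1 k (f : T -> \bar R) : measurable_fun setT f ->
  (forall w, 0 <= f w) -> (forall w, f w <= 1) -> forall w, draw k f w <= 1.
Proof.
move=> mf f0 f1 w; apply: le_trans (_ : draw k (cst 1) w <= _).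
  exact: draw_le.
by rewrite draw_id.
Qed.

Section initial_kernel.
Variable k : nat.
Definition initial_kernel (w : T) : {measure set X -> \bar R} :=
  K k (initial k w).

Let measurable_kernel U : measurable U ->
  measurable_fun setT (initial_kernel ^~ U).
Proof.
move=> mU; apply: (measurableT_comp (measurable_kernel (K k) U mU)).
exact: measurable_initial.
Qed.

HB.instance Definition _ :=
  isKernel.Build _ _ _ _ _ initial_kernel measurable_kernel.

Let prob w : initial_kernel w setT = 1.
Proof. exact: prob_kernel. Qed.

HB.instance Definition _ :=
  Kernel_isProbability.Build _ _ _ _ _ initial_kernel prob.

End initial_kernel.

Lemma measurable_draw k (f : T -> \bar R) : measurable_fun setT f ->
  (forall w, 0 <= f w) -> measurable_fun setT (draw k f : T -> _).
Proof.
move=> mf f0.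
apply: (measurable_fun_integral_finite_kernel
  (fun z : T * X => f (update z.1 k z.2)) (@initial_kernel k)) => //.
by apply: (measurableT_comp mf); exact: measurable_update.
Qed.

(** Dominated convergence with bound 1. Its use is contrapositive: if the conditional expectations
    do not tend to 0, some value of the next coordinate keeps them from tending to 0. *)
Lemma draw_cvg0 k (f_ : nat -> T -> \bar R) w :
  (forall n, measurable_fun setT (f_ n)) -> (forall n w, 0 <= f_ n w <= 1) ->
  (forall r, f_ n (update w k r) @[n --> \oo] --> 0) ->
  draw k (f_ n) w @[n --> \oo] --> 0.
Proof.
move=> mf f01 cf.
have mfu n : measurable_fun setT (fun r => f_ n (update w k r)).
  by apply: (measurableT_comp (mf n)); exact: measurable_updater.
have := @dominated_convergence _ _ _ (K k (initial k w)) setT measurableT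
  (fun n r => f_ n (update w k r)) (cst 0) (cst 1) mfu.
case=> //.
- by apply: aeW => r _; exact: cf.
- apply/integrableP; split => //.
  by rewrite integral_cst//= prob_kernel mule1 normr1 ltry.
- apply: aeW => r n _.
  by have /andP[f0 f1] := f01 n (update w k r); rewrite gee0_abs.
- by move=> _ _; rewrite integral0.
Qed.

(* [draws n m f w]: conditional expectation of [f] given that the first [m]
   coordinates are those of [w], if [f] is determined by the first [m + n]. *)
Fixpoint draws n m (f : (nat -> X) -> \bar R) : (nat -> X) -> \bar R :=
  if n is n'.+1 then draw m (draws n' m.+1 f) else f.

Lemma drawsSr n m f : draws n.+1 m f = draws n m (draw (m + n) f).
Proof.
elim: n m => [|n IHn] m; first by rewrite /= addn0.
by rewrite /= in IHn *; rewrite IHn addSnnS.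
Qed.

Lemma draws_facts n m (f : T -> \bar R) : measurable_fun setT f ->
  (forall w, 0 <= f w <= 1) ->
  measurable_fun setT (draws n m f : T -> _) /\
  forall w, 0 <= draws n m f w <= 1.
Proof.
move=> mf f01; elim: n m => [//|n IHn] m /=.
have [mg g01] := IHn m.+1.
have g0 w : 0 <= draws n m.+1 f w by have /andP[] := g01 w.
have g1 w : draws n m.+1 f w <= 1 by have /andP[] := g01 w.
split; first exact: measurable_draw.
by move=> w; rewrite draw_ge0//= draw_le1.
Qed.

Lemma draws_le n m (f g : T -> \bar R) :
  measurable_fun setT f -> measurable_fun setT g ->
  (forall w, 0 <= f w <= 1) -> (forall w, 0 <= g w <= 1) ->
  (forall w, f w <= g w) -> forall w, draws n m f w <= draws n m g w.
Proof.
move=> mf mg f01 g01 fg; elim: n m => [//|n IHn] m /= w.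
have [mf' f'01] := draws_facts n m.+1 mf f01.
have [mg' g'01] := draws_facts n m.+1 mg g01.
by apply: draw_le => // w'; have /andP[] := f'01 w'.
Qed.

Lemma draws_determined N n m f : determined N f -> (N <= m + n)%N ->
  determined m (draws n m f).
Proof.
move=> fN; elim: n m => [|n IHn] m; first by rewrite addn0 => /determinedW;
  exact.
by rewrite -addSnnS => /IHn /determined_draw.
Qed.

(** The additional draws integrate functions that do not depend on the coordinate drawn, and the
    kernels have mass 1. This is the consistency of the finite-dimensional laws. *)
Lemma draws_stable N n n' m f : determined N f -> (N <= m + n)%N ->
  (n <= n')%N -> draws n' m f = draws n m f.
Proof.
move=> fN Nmn /subnK <-; elim: (n' - n)%N => // j <-.
rewrite addSn drawsSr draw_id//; apply: determinedW fN.
by rewrite (leq_trans Nmn)// leq_add2l leq_addl.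
Qed.

Lemma draws_id N n m f : determined N f -> (N <= m)%N -> draws n m f = f.
Proof.
by move=> fN Nm; rewrite (draws_stable (n := 0) fN)// addn0.
Qed.

Local Notation ind := (fun (C : set (nat -> X)) w => (\1_C w)%:E : \bar R).

Lemma cylinder_sets_measurable (C : set T) : cylinder_sets C -> measurable C.
Proof. exact: sub_sigma_algebra. Qed.

Lemma measurable_ind (C : set T) : measurable C ->
  measurable_fun setT (ind C : T -> \bar R).
Proof. by move=> mC; apply/measurable_EFinP; exact: measurable_indic. Qed.

Lemma ind01 C w : 0 <= ind C w <= 1.
Proof. by rewrite !lee_fin indicE; case: (w \in C);
  rewrite /= ?lexx ?ler01. Qed.

(** * Continuity of the content at the empty set *)

Section continuity_at_empty.
Variables (C : nat -> set T) (N : nat -> nat) (w0 : nat -> X).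
Hypothesis mC : forall n, measurable (C n).
Hypothesis CN : forall n, determined (N n) (ind (C n)).
Hypothesis ndC : forall n m, (n <= m)%N -> C m `<=` C n.
Hypothesis C0 : \bigcap_n C n = set0.

(** The conditional probability of [C n] given the first [m] coordinates. Subtraction being
    truncated, it is the indicator of [C n] as soon as [N n <= m]. *)
Let g m n := draws (N n - m) m (ind (C n)).

Let mg m n : measurable_fun setT (g m n : T -> _).
Proof. exact: (draws_facts _ _ (measurable_ind (mC n)) (ind01 (C n))).1. Qed.

Let g01 m n w : 0 <= g m n w <= 1.
Proof. exact: (draws_facts _ _ (measurable_ind (mC n)) (ind01 (C n))).2. Qed.

Let gS m n : g m n = draw m (g m.+1 n).
Proof.
rewrite /g; case: (ltnP m (N n)) => mN; first by rewrite -(subnSK mN).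
have -> : (N n - m = 0)%N by apply/eqP; rewrite subn_eq0.
have -> : (N n - m.+1 = 0)%N by apply/eqP; rewrite subn_eq0 ltnW.
by rewrite /= draw_id//; exact: determinedW mN (@CN n).
Qed.

Let determined_g m n : determined m (g m n).
Proof. by apply: draws_determined (@CN n) _; rewrite -leq_subLR. Qed.

(* If the measures did not tend to 0, one could choose the coordinates one by
   one so that the conditional probabilities of the [C n] never tend to 0; the
   resulting sequence would lie in all the [C n]. *)
Lemma draws_cvg0 : draws (N n) 0 (ind (C n)) w0 @[n --> \oo] --> 0.
Proof.
pose bad m w := ~ (g m n w @[n --> \oo] --> 0).
(* The implication is put under the existential so that a choice function exists on all pairs, with
   the dummy [point] where nothing is to be kept. *)
have step (z : nat * (nat -> X)) :
    exists r, bad z.1 z.2 -> bad z.1.+1 (update z.2 z.1 r).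
  have [bz|] := pselect (bad z.1 z.2); last by exists point.
  have [|h] := pselect (exists r, bad z.1.+1 (update z.2 z.1 r)).
    by move=> [r ?]; exists r.
  exfalso; apply: bz; under eq_fun do rewrite gS.
  apply: draw_cvg0 => // r.
  by apply: contrapT => hr; apply: h; exists r.
have {step}[F FP] := choice step.
apply: contrapT => bad0.
pose W := fix W m := if m is m'.+1 then update (W m') m' (F (m', W m')) else w0.
have badW m : bad m (W m).
  elim: m => [|m IHm]; last exact: (FP (m, W m)).
  by rewrite /bad /g /=; under eq_fun do rewrite subn0.
(* Stage [i.+1] fixes coordinate [i] for good, so the diagonal sequence agrees with [W m] on the
   first [m] coordinates. *)
pose w i := W i.+1 i.
have wW m i : (i < m)%N -> w i = W m i.
  elim: m => // m IHm; rewrite ltnS leq_eqVlt => /predU1P[->//|im].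
  by rewrite (IHm im) /= /update ltn_eqF.
have badw m : bad m w.
  rewrite /bad; under eq_fun do rewrite (determined_g _ (wW m)).
  exact: badW.
suff : (\bigcap_n C n) w by rewrite C0.
(* For [j >= n] the conditional probability of [C j] given the first [N n] coordinates of [w] is at
   most that of [C n], which is the indicator of [C n] at [w], that is 0. The sequence is then
   eventually 0, against [badw]. *)
move=> n _; apply: contrapT => wCn; apply: (badw (N n)).
apply: cvg_near_cst; exists n => // j /= nj.
apply/eqP; rewrite eq_le; have /andP[-> _] := g01 (N n) j w; rewrite andbT.
have := draws_le (N j - N n) (N n) (measurable_ind (mC j))
  (measurable_ind (mC n)) (ind01 (C j)) (ind01 (C n)).
move=> /(_ _ w) h; apply: (le_trans (h _)).
  move=> w'; rewrite lee_fin !indicE.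
  have [/set_mem jw'|_] := boolP (w' \in C j); last by case: (_ \in _).
  by rewrite mem_set//; exact: ndC jw'.
by rewrite (draws_id _ (@CN n))// indicE memNset.
Qed.

End continuity_at_empty.

(** * The content of cylinders and its extension to a probability *)

Variable w0 : nat -> X.

(** A second copy of the space of sequences, whose measurable sets are the algebra of cylinders and
    not the sigma-algebra they generate: the domain of the content to be extended. *)
Definition cylinder_space : Type := nat -> X.

HB.instance Definition _ := Pointed.on cylinder_space.

HB.instance Definition _ := isAlgebraOfSets.Build default_measure_display
  cylinder_space cylinder_sets0 cylinder_setsU cylinder_setsC.

(** On cylinders the value depends neither on the number of coordinates picked by [xget], by
    [draws_stable], nor on [w0], since all the coordinates it depends on are drawn. *)
Definition cylinder_content (C : set cylinder_space) : \bar R :=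
  draws (xget 0%N [set N | determined N (ind C)]) 0 (ind C) w0.

Lemma cylinder_contentE N n (C : set T) : determined N (ind C) -> (N <= n)%N ->
  cylinder_content C = draws n 0 (ind C) w0.
Proof.
move=> CN Nn; rewrite /cylinder_content.
have : determined (xget 0%N [set N | determined N (ind C)]) (ind C).
  by apply: (@xgetPex _ 0%N [set N | determined N (ind C)]); exists N.
move: (xget _ _) => M CM.
rewrite -(draws_stable (n' := maxn M n) (m := 0) CM) ?leq_maxl//.
by rewrite (draws_stable (n := n) (m := 0) CN) ?leq_maxr.
Qed.

Lemma cylinder_content0 : cylinder_content set0 = 0.
Proof.
by rewrite (@cylinder_contentE 0 0)//= ?indic0// => w w' _; rewrite indic0.
Qed.

Lemma cylinder_content_ge0 C : 0 <= cylinder_content C.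
Proof.
suff h n m (f : (nat -> X) -> \bar R) :
    (forall w, 0 <= f w) -> forall w, 0 <= draws n m f w.
  by apply: h => w; have /andP[] := ind01 C w.
move=> f0; elim: n m => [//|n IHn] m w.
by rewrite /= /draw; apply: integral_ge0 => r _; exact: IHn.
Qed.

Lemma cylinder_content_le1 C : cylinder_sets C -> cylinder_content C <= 1.
Proof.
move=> cC; have [N CN] := cylinder_sets_determined cC.
rewrite (cylinder_contentE CN (leqnn N)).
have := (draws_facts N 0 (measurable_ind (cylinder_sets_measurable cC)) (ind01
  C)).2.
by move=> /(_ w0) /andP[].
Qed.

Lemma draws_add n m (f g : T -> \bar R) :
  measurable_fun setT f -> measurable_fun setT g ->
  (forall w, 0 <= f w <= 1) -> (forall w, 0 <= g w <= 1) ->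
  draws n m (f \+ g) = draws n m f \+ draws n m g.
Proof.
move=> mf mg f01 g01; elim: n m => //= n IHn m; rewrite {}IHn.
have [mf' f'01] := draws_facts n m.+1 mf f01.
have [mg' g'01] := draws_facts n m.+1 mg g01.
apply/funext => w; rewrite /draw /= ge0_integralD//.
- by move=> r _; have /andP[] := f'01 (update w m r).
- by apply: (measurableT_comp mf'); exact: measurable_updater.
- by move=> r _; have /andP[] := g'01 (update w m r).
- by apply: (measurableT_comp mg'); exact: measurable_updater.
Qed.

Lemma cylinder_contentU (A B : set T) : cylinder_sets A -> cylinder_sets B ->
  A `&` B = set0 -> cylinder_content (A `|` B) =
  cylinder_content A + cylinder_content B.
Proof.
move=> cA cB AB0.
have [N1 AN] := cylinder_sets_determined cA.
have [N2 BN] := cylinder_sets_determined cB.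
have [N3 CN] := cylinder_sets_determined (cylinder_setsU cA cB).
pose N := (N1 + N2 + N3)%N.
rewrite (cylinder_contentE (n := N) AN)/N; last by rewrite -addnA leq_addr.
rewrite (cylinder_contentE (n := N) BN)/N; last by rewrite addnAC leq_addl.
rewrite (cylinder_contentE (n := N) CN)/N; last by rewrite leq_addl.
have -> : ind (A `|` B) = ind A \+ ind B.
  apply/funext => w; rewrite /= !indicE -EFinD -natrD in_setU.
  have [/set_mem Aw|_] := boolP (w \in A); last by [].
  rewrite memNset// => Bw.
  by have : (A `&` B) w by []; rewrite AB0.
rewrite draws_add//; by [apply: measurable_ind;
  exact: cylinder_sets_measurable | exact: ind01].
Qed.

(** By finite additivity the partial sums fall short of the content of the union by that of a
    remainder. The remainders decrease to the empty set, so [draws_cvg0] applies. *)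
Lemma cylinder_content_sigma_additive : semi_sigma_additive cylinder_content.
Proof.
move=> F cF tF cUF.
pose U n : set T := \big[setU/set0]_(i < n) F i.
have cU n : cylinder_sets (U n).
  rewrite /U; elim/big_ind : _ => [|A B|i _]; last exact: cF.
    exact: cylinder_sets0.
  exact: cylinder_setsU.
pose C n : set T := (\bigcup_i F i) `\` U n.
have cC : forall k, cylinder_sets (C k).
  move=> k.
  rewrite /C setDE -[X in cylinder_sets X]setCK setCI setCK.
  apply/cylinder_setsC/cylinder_setsU; last exact: cU.
  exact: (cylinder_setsC cUF).
have UE n : \sum_(0 <= i < n) cylinder_content (F i) = cylinder_content (U n).
  rewrite big_mkord; elim: n => [|n IHn].
    by rewrite /U !big_ord0 cylinder_content0.
  have -> : U n.+1 = U n `|` F n by rewrite /U big_ord_recr.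
  rewrite big_ord_recr/= IHn cylinder_contentU//; first exact: cF.
  apply/seteqP; split => // w [].
  rewrite /U -bigcup_mkord => -[i /= im Fi] Fn.
  move/trivIsetP : tF => /(_ i n Logic.I Logic.I).
  rewrite ltn_eqF// => /(_ isT) FF0.
  by have : (F i `&` F n) w by []; rewrite FF0.
have SE n : \sum_(0 <= i < n) cylinder_content (F i) =
    cylinder_content (\bigcup_i F i) - cylinder_content (C n).
  rewrite UE [in RHS](_ : \bigcup_i F i = U n `|` C n).
    rewrite cylinder_contentU//; last by rewrite /C setDIK.
    rewrite addeK// ge0_fin_numE ?cylinder_content_ge0//.
    by rewrite (le_lt_trans (cylinder_content_le1 (cC n)))// ltry.
  rewrite /C setDUK// /U -bigcup_mkord => x [i _ Fix]; by exists i.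
under eq_fun do rewrite SE.
suff : cylinder_content (\bigcup_i F i) - cylinder_content (C n) @[n --> \oo]
    --> cylinder_content (\bigcup_i F i) - 0 by rewrite sube0.
apply: cvgeB; [by rewrite fin_num_adde_defl|exact: cvg_cst|].
have /choice[N CN] : forall n, exists N, determined N (ind (C n)).
  by move=> n; exact: cylinder_sets_determined.
under eq_fun do rewrite (cylinder_contentE (@CN _) (leqnn _)).
apply: draws_cvg0 => //.
- by move=> n; exact: cylinder_sets_measurable.
- move=> n m nm; apply: setDS.
  rewrite /U -!bigcup_mkord => x [i /= im Fix]; exists i => //=.
  exact: leq_trans nm.
- apply/seteqP; split => // w /= h.
  have [[i _ Fiw] _] := h 0%N Logic.I.
  have [_] := h i.+1 Logic.I; apply.
  by rewrite /U -bigcup_mkord; exists i => /=.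
Qed.

HB.instance Definition _ := isMeasure.Build _ _ _ cylinder_content
  cylinder_content0 cylinder_content_ge0 cylinder_content_sigma_additive.

Definition tulcea_measure : {measure set T -> \bar R} :=
  (measure_extension cylinder_content : {measure set
    (g_sigma_algebraType (@measurable _ cylinder_space)) -> \bar R}).

Lemma tulcea_measureE C : cylinder_sets C ->
  tulcea_measure C = cylinder_content C.
Proof.
by move=> cC; apply: (@measurable_mu_extE _ R cylinder_space cylinder_content).
Qed.

Lemma tulcea_measure_setT : tulcea_measure setT = 1.
Proof.
rewrite tulcea_measureE; last first.
  by rewrite -setC0; apply: cylinder_setsC; exact: cylinder_sets0.
by rewrite (@cylinder_contentE 0 0)//= ?indicT// => w w' _; rewrite indicT.
Qed.

Let law : set T -> \bar R := tulcea_measure.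

HB.instance Definition _ := Measure.copy law tulcea_measure.

HB.instance Definition _ := Measure_isProbability.Build _ _ _ law
  tulcea_measure_setT.

Definition tulcea_law : probability T R := law.

Section extend_kernel.
Variable k : nat.

Definition extend_kernel (w : T) : {measure set T -> \bar R} :=
  image_measure (K k (initial k w)) (measurable_updater w k).

Lemma integral_extend_kernel (f : T -> \bar R) w : (forall w, 0 <= f w) ->
  measurable_fun setT f -> \int[extend_kernel w]_w' f w' = draw k f w.
Proof.
move=> f0 mf; rewrite /extend_kernel ge0_integral_pushforward//.
exact: measurable_updater.
Qed.

Lemma extend_kernelE (A : set T) w : measurable A ->
  extend_kernel w A = draw k (ind A) w.
Proof.
move=> mA; rewrite -integral_extend_kernel.
- by rewrite integral_indic// setIT.
- by move=> w'; have /andP[] := ind01 A w'.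
- exact: measurable_ind.
Qed.

Let measurable_kernel U : measurable U ->
  measurable_fun setT (extend_kernel ^~ U).
Proof.
move=> mU; have -> : extend_kernel ^~ U = (draw k (ind U) : T -> \bar R).
  by apply/funext => w; rewrite extend_kernelE.
apply: measurable_draw; first exact: measurable_ind.
by move=> w; have /andP[] := ind01 U w.
Qed.

HB.instance Definition _ :=
  isKernel.Build _ _ _ _ _ extend_kernel measurable_kernel.

End extend_kernel.

(** Iterated draws are integration against a Dirac mass mixed successively by the one-step kernels.
    Having an actual measure allows a comparison with the extended law on sets, which then carries
    over to integrals. *)
Lemma draws_measure n : exists m : {measure set T -> \bar R},
  forall f : T -> \bar R, (forall w, 0 <= f w) -> measurable_fun setT f ->
    \int[m]_w f w = draws n 0 f w0.
Proof.
elim: n => [|n [m mE]].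
  by exists (\d_(w0 : T)) => f f0 mf; rewrite integral_dirac// diracT mul1e.
exists (mixture m (@extend_kernel n)) => f f0 mf.
rewrite (integral_mixture (measurable_kernel (@extend_kernel n)) (P := m))//.
rewrite drawsSr add0n.
under eq_integral do rewrite integral_extend_kernel//.
by rewrite mE//; [exact: draw_ge0|exact: measurable_draw].
Qed.

(** The event is a cylinder on [k.+1] coordinates. Its last draw leaves the function [h] of the
    first [k] ones, and under both the law and [k] draws these have the same distribution. *)
Lemma tulcea_lawP k (B : set (k.-tuple X)) (A : set X) :
  measurable B -> measurable A ->
  tulcea_law [set w : T | B (initial k w) /\ A (w k)] =
  \int[tulcea_law]_(w in [set w : T | B (initial k w)]) K k (initial k w) A.
Proof.
move=> mB mA.
set C := [set w : T | _].
have cC : cylinder_sets C.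
  exists k.+1, [set t | B [tuple tnth t (widen_ord (leqnSn k) i) | i < k] /\
                        A (tnth t ord_max)]; split.
    apply: measurableI; rewrite -[X in measurable X]setTI.
      suff : measurable_fun setT (fun t : k.+1.-tuple X =>
          [tuple tnth t (widen_ord (leqnSn k) i) | i < k]) by exact.
      apply/measurable_fun_tnthP => i.
      rewrite (_ : _ \o _ = fun t => tnth t (widen_ord (leqnSn k) i)).
        exact: measurable_tnth.
      by apply/funext => t /=; rewrite tnth_mktuple.
    by apply: (@measurable_tnth _ X k.+1 ord_max).
  rewrite /C; apply/seteqP; split => w /=; rewrite tnth_mktuple/=;
    (have -> : [tuple tnth (initial k.+1 w) (widen_ord (leqnSn k) i) | i < k] =
      initial k w by apply: eq_from_tnth => i; rewrite !tnth_mktuple); exact.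
have Cdet : determined k.+1 (ind C).
  move=> w w' ww'; rewrite !indicE; congr ((nat_of_bool _)%:R%:E).
  have e : initial k w = initial k w'.
    by apply: determined_initial => i ik; apply: ww'; exact: ltnW.
  by apply/idP/idP => /[!inE]; rewrite /C /= e ww'.
rewrite [LHS](tulcea_measureE cC) (cylinder_contentE Cdet (leqnn _)).
rewrite drawsSr add0n.
pose h t : \bar R := ((K k t A) * (\1_B t)%:E).
have h0 t : 0 <= h t by rewrite mule_ge0// lee_fin indicE.
have mh : measurable_fun setT h.
  apply: emeasurable_funM; first exact: measurable_kernel.
  by apply/measurable_EFinP; exact: measurable_indic.
have -> : draw k (ind C) = h \o initial k.
  apply/funext => w; rewrite /draw /h /=.
  have eC r : (update w k r \in C) = (initial k w \in B) && (r \in A).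
    have e : initial k (update w k r) = initial k w.
      by apply: (@determined_update _ k (@initial k));
        exact: determined_initial.
    have er : update w k r k = r by rewrite /update eqxx.
    apply/idP/andP => [|[]]; rewrite !inE /C /= e er; first by case.
    by move=> Bw Ar; split.
  rewrite indicE; under eq_integral do rewrite indicE eC.
  case: (initial k w \in B) => /=; last by rewrite mule0 integral0.
  by rewrite mule1 integral_indic// setIT.
rewrite integral_mkcond.
transitivity (\int[tulcea_law]_w (h \o initial k) w); last first.
  apply: eq_integral => w _; rewrite patchE /h /= indicE.
  have -> : (w \in [set w : T | B (initial k w)]) = (initial k w \in B).
    by apply/idP/idP => /[!inE].
  by case: ifPn => _; rewrite ?mule1 ?mule0.
have [m mE] := draws_measure k.
have mhi : measurable_fun setT (h \o initial k : T -> \bar R).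
  by apply: (measurableT_comp mh); exact: measurable_initial.
transitivity (\int[m]_w (h \o initial k) w).
  by rewrite mE//= => w; exact: h0.
have image_h (mu : {measure set T -> \bar R}) : \int[mu]_w (h \o initial k) w =
    \int[image_measure mu (@measurable_initial k)]_t h t.
  by rewrite [RHS]ge0_integral_pushforward//; exact: measurable_initial.
rewrite !image_h.
(* The preimage of [D] is a cylinder on [k] coordinates, where the law is by construction the result
   of [k] draws. *)
apply: eq_measure_integral => D mD _; rewrite /= /image_measure /pushforward.
have cD : cylinder_sets (initial k @^-1` D) by exists k, D.
rewrite [RHS](tulcea_measureE cD) (cylinder_contentE (@determined_cylinder k D)
  (leqnn k)).
rewrite -mE; last 2 first.
- by move=> w; have /andP[] := ind01 (initial k @^-1` D) w.
- by apply: measurable_ind; exact: cylinder_sets_measurable.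
by rewrite integral_indic ?setIT//; exact: cylinder_sets_measurable.
Qed.

End ionescu_tulcea.

(** * Balls of the Euclidean norm and their Lebesgue measure *)

Section euclidean_space.
Context (R : realType) (n : nat).
Implicit Types (x y v : 'rV[R]_n) (A : set 'rV[R]_n).

Lemma enorm_ge0 v : 0 <= enorm v.
Proof. exact: sqrtr_ge0. Qed.

Lemma enormZ (a : R) v : enorm (a *: v) = `|a| * enorm v.
Proof.
rewrite /enorm -sqrtr_sqr -sqrtrM ?sqr_ge0// mulr_sumr.
by congr Num.sqrt; apply: eq_bigr => i _; rewrite mxE exprMn.
Qed.

Lemma enorm0 : enorm (0 : 'rV[R]_n) = 0.
Proof. by rewrite -(scale0r 0) enormZ normr0 mul0r. Qed.

Lemma ler_coord_enorm v i : `|v ord0 i| <= enorm v.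
Proof.
rewrite -sqrtr_sqr; apply: ler_wsqrtr; rewrite (bigD1 i)//= lerDl.
by apply: sumr_ge0 => j _; exact: sqr_ge0.
Qed.

Lemma enorm_le_sum v : enorm v <= \sum_i `|v ord0 i|.
Proof.
(* Nonnegativity of the sum is carried along in the induction: it makes the cross term of the square
   nonnegative. *)
rewrite -[leRHS]ger0_norm ?sumr_ge0// -sqrtr_sqr; apply: ler_wsqrtr.
suff [] : 0 <= \sum_(i < n) `|v ord0 i| /\
  \sum_(i < n) v ord0 i ^+ 2 <= (\sum_(i < n) `|v ord0 i|) ^+ 2 by [].
elim/big_ind2 : _ => [|a b c d [a0 ba] [c0 dc]|i _].
- by rewrite expr0n.
- by split; nra.
- by rewrite real_normK ?num_real.
Qed.

Lemma continuous_enorm : continuous (@enorm R n).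
Proof.
move=> v; apply: (@continuous_comp _ _ _ _ (@Num.sqrt R));
  last exact: sqrt_continuous.
rewrite (_ : (fun _ => _) = \sum_(i < n) (fun v => v ord0 i ^+ 2)); last first.
  by apply/funext => w; rewrite fct_sumE.
elim/big_ind : _ => [|f g cf cg|i _].
- exact: cst_continuous.
- exact: continuousD.
- apply: (@continuous_comp _ _ _ (fun w :
    'rV[R]_n => w ord0 i) (fun r => r ^+ 2)).
    exact: coord_continuous.
  exact: exprn_continuous.
Qed.

Lemma eball_le0 x t : t <= 0 -> eball x t = set0.
Proof.
by move=> t0; rewrite -subset0 => v;
  rewrite /eball /= ltNge (le_trans t0) ?enorm_ge0.
Qed.

Lemma open_eball x t : open (eball x t).
Proof.
rewrite (_ : eball x t = (fun y => enorm (y - x)) @^-1` [set r | r < t])//.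
apply: open_comp; last exact: open_lt.
move=> y _; apply: continuous_comp; last exact: continuous_enorm.
by apply: continuousB => //; exact: cst_continuous.
Qed.

Lemma open_measurable_rV A : open A -> measurable A.
Proof. exact: sub_sigma_algebra. Qed.

Lemma measurable_eball x t : measurable (eball x t).
Proof. by apply: open_measurable_rV; exact: open_eball. Qed.

Lemma continuous_measurable_rV (f : 'rV[R]_n -> R) :
  continuous f -> measurable_fun setT f.
Proof.
move=> /continuousP cf; apply: (measurability _ (RGenOpens.measurableE R)) =>
  //.
move=> _ [_ [a [b ->]] <-]; rewrite setTI; apply: open_measurable_rV.
by apply: cf; exact: interval_open.
Qed.

Lemma measurable_coord i : measurable_fun setT (fun v : 'rV[R]_n => v ord0 i).
Proof. by apply: continuous_measurable_rV; exact: coord_continuous. Qed.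

Lemma measurable_fun_enormB d (T : measurableType d) (f g : T -> 'rV[R]_n) :
  measurable_fun setT f -> measurable_fun setT g ->
  measurable_fun setT (fun z => enorm (f z - g z)).
Proof.
move=> mf mg; rewrite /enorm.
have ms : measurable_fun setT (@Num.sqrt R).
  by apply: continuous_measurable_fun; exact: sqrt_continuous.
apply: (measurableT_comp ms); apply: measurable_sum => i.
apply: measurable_funX.
rewrite (_ : (fun _ => _) = (fun z => f z ord0 i) \- (fun z => g z ord0 i)).
  by apply: measurable_funB;
    [exact: (measurableT_comp (measurable_coord i) mf)
    |exact: (measurableT_comp (measurable_coord i) mg)].
by apply/funext => z; rewrite !mxE.
Qed.

(** A distance at most [e] means that every radius [e + 1 / (k + 1)] reaches [A], a countable
    intersection of open conditions. For empty [A] the infimum is 0 by convention, and the set is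
    everything or nothing. *)
Lemma measurable_edist_le A (e : R) : measurable [set x | edist_set x A <= e].
Proof.
have [->|/set0P[a Aa]] := eqVneq A set0.
  rewrite (_ : [set x | _] = if 0 <= e then setT else set0); first by case: ifP.
  apply/seteqP; split => x /=; rewrite /edist_set image_set0 inf0.
    by move=> ->.
  by case: ifP.
have hi x : has_inf [set enorm (x - y) | y in A].
  split; first by exists (enorm (x - a)), a.
  by exists 0 => _ [y _ <-]; exact: enorm_ge0.
rewrite (_ : [set x | _] =
    \bigcap_k \bigcup_(y in A) eball y (e + k.+1%:R^-1)).
  apply: bigcapT_measurable => k; apply: open_measurable_rV.
  by apply: bigcup_open => y _; exact: open_eball.
apply/seteqP; split => x /=.
  move=> xe k _; have k0 : 0 < k.+1%:R^-1 :> R by rewrite invr_gt0.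
  have [_ [y Ay <-] xy] := inf_adherent k0 (hi x).
  by exists y => //; rewrite /eball /= (lt_le_trans xy)// lerD2r.
move=> h; rewrite leNgt; apply/negP => ex.
have [k ke] : exists k, k.+1%:R^-1 < edist_set x A - e.
  have [k _ hk] := near_infty_natSinv_lt (PosNum (etrans (subr_gt0 _ _) ex)).
  by exists k; exact: hk (leqnn k).
have [y Ay] := h k Logic.I; rewrite /eball /= => xy.
have : edist_set x A <= enorm (x - y).
  by apply: ge_inf; [exact: (hi x).2|exists y].
by apply/negP; rewrite -ltNge (lt_trans xy)// -ltrBrDl.
Qed.

(** The point [b] is where the segment from [x] to [y] first leaves [A]: it is outside [A], as [A]
    is open, and a limit of points of the segment in [A]. *)
Lemma segment_meets_boundary A x y : open A -> A x -> ~ A y ->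
  exists2 b, boundary A b & enorm (y - b) <= enorm (y - x).
Proof.
move=> oA Ax nAy.
pose c (s : R) := x + s *: (y - x).
pose S := [set s : R | 0 <= s /\ ~ A (c s)].
have S1 : S 1 by split => //; rewrite /c scale1r addrC subrK.
have hS : has_inf S by split; [exists 1|exists 0 => s []].
have cont_c : continuous c.
  move=> s; rewrite /c; apply: cvgD; first exact: cvg_cst.
  exact: scalel_continuous.
pose s := inf S.
have s0 : 0 <= s by apply: lb_le_inf; [exists 1|move=> r []].
have s1 : s <= 1 by apply: ge_inf => //; exact: hS.2.
have lt_s r : 0 <= r -> r < s -> A (c r).
  move=> r0 rs; apply: contrapT => nAr.
  have : s <= r by apply: ge_inf; [exact: hS.2|].
  by rewrite leNgt rs.
have nAs : ~ A (c s).
  move=> As.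
  have /cont_c/nbhs_ballP[e /= e0 he] : nbhs (c s) A by exact: open_nbhs_nbhs.
  have [r Sr rs] := inf_adherent e0 hS.
  have sr : s <= r by apply: ge_inf => //; exact: hS.2.
  have {}rs : r < s + e := rs.
  by apply: Sr.2; apply: he; rewrite /ball /= ltr_distlC; lra.
have sgt0 : 0 < s.
  rewrite lt_neqAle s0 andbT; apply/eqP => s_0; apply: nAs.
  by rewrite -s_0 /c scale0r addr0.
exists (c s); last first.
  rewrite (_ : y - c s = (1 - s) *: (y - x)).
    rewrite enormZ ger0_norm ?subr_ge0// ler_piMl ?enorm_ge0//.
    by rewrite gerBl.
  by rewrite /c scalerBl scale1r opprD addrA.
split; last first.
  by rewrite (interior_id _).1.
move=> B /cont_c/nbhs_ballP[e /= e0 he].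
pose r := Num.max 0 (s - e / 2).
have rs : r < s by rewrite /r gt_max sgt0 gtrBl divr_gt0.
exists (c r); split; first by apply: lt_s => //; rewrite /r le_max lexx.
apply: he; rewrite /ball /= ltr_distlC.
have e2 : e / 2 < e by rewrite gtr_pMr// invf_lt1// ltr1n.
have re : s - e / 2 <= r by rewrite /r le_max lexx orbT.
lra.
Qed.

End euclidean_space.

(** * Lebesgue measure of cubes, and bounds for balls *)

Section lebesgue_rV_cubes.
Context (R : realType).

(** Cubes are measured exactly by the iterated product. Balls are only compared with them, which
    gives the finiteness, positivity and upper bound of their measure that the proof relies on. *)
Definition cube n (a : 'rV[R]_n) (s : R) : set 'rV[R]_n :=
  [set v | forall i, a ord0 i < v ord0 i < a ord0 i + s].

Lemma measurable_cube n (a : 'rV[R]_n) s : measurable (cube a s).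
Proof.
rewrite (_ : cube a s = \bigcap_(i in [set: 'I_n])
    ((fun v : 'rV[R]_n => v ord0 i) @^-1` `]a ord0 i, a ord0 i + s[%classic)).
  apply: fin_bigcap_measurable => // i _.
  by rewrite -[X in measurable X]setTI; apply: measurable_coord.
apply/seteqP; split => [v h i _|v h i] /=.
  by rewrite in_itv /=; exact: h.
by have := h i Logic.I; rewrite /= in_itv.
Qed.

Lemma lebesgue_tuple_cube k (a : 'I_k -> R) (s : R) : 0 <= s ->
  lebesgue_tuple R k
    [set t : k.-tuple (measurableTypeR R) | forall i,
      a i < tnth t i < a i + s] = (s ^+ k)%:E.
Proof.
move=> s0; elim: k a => [|k IHk] a.
  by rewrite expr0 /= (_ : [set t | _] = setT) ?diracT//; apply/seteqP;
    split => // t _ [].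
pose B := [set t : k.-tuple (measurableTypeR R) |
  forall i, a (lift ord0 i) < tnth t i < a (lift ord0 i) + s].
have mB : measurable B.
  rewrite (_ : B = \bigcap_(i in [set: 'I_k]) ((fun t => tnth t i) @^-1`
      (`]a (lift ord0 i), a (lift ord0 i) + s[%classic :
        set (measurableTypeR R)))).
    apply: fin_bigcap_measurable => // i _.
    by rewrite -[X in measurable X]setTI; apply: measurable_tnth.
  apply/seteqP; split => [v h i _|v h i] /=.
    by rewrite in_itv /=; exact: h.
  by have := h i Logic.I; rewrite /= in_itv.
rewrite /= /image_measure /pushforward.
rewrite [X in (_ \x^ _)%E X](_ : _ = `]a ord0, a ord0 + s[%classic `*` B);
  last first.
  apply/seteqP; split => [[x t] h|[x t] [/= h1 h2] i].
    split => /=; first by have := h ord0; rewrite in_itv.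
    by move=> i; have := h (lift ord0 i); rewrite /tcons tnthS.
  have [->|[j ->]] : i = ord0 \/ exists j, i = lift ord0 j.
    by case: (unliftP ord0 i) => [j ->|->]; [right; exists j|left].
    by move: h1; rewrite in_itv.
  by have := h2 j; rewrite /tcons tnthS.
have l : lebesgue_measure `]a ord0, a ord0 + s[%classic = s%:E.
  rewrite lebesgue_measure_itv /= lte_fin ltrDl.
  move: s0; rewrite le_eqVlt => /predU1P[<-|->]; first by rewrite ltxx.
  by rewrite -EFinB addrC addKr.
rewrite product_measure2E// exprS EFinM.
by congr (_ * _)%E; [exact: l|exact: IHk].
Qed.

Lemma lebesgue_rV_cube n (a : 'rV[R]_n) (s : R) : 0 <= s ->
  lebesgue_rV R n (cube a s) = (s ^+ n)%:E.
Proof.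
move=> s0; rewrite -(lebesgue_tuple_cube (a ord0) s0).
rewrite /lebesgue_rV /= /image_measure /pushforward;
  congr (lebesgue_tuple _ _ _).
by apply/seteqP; split => t h i; have := h i; rewrite /row_of_tuple mxE.
Qed.

Lemma lebesgue_rV_sigma_finite n : sigma_finite setT (lebesgue_rV R n).
Proof.
exists (fun k => cube (\row_(i < n) (- k%:R)) (k%:R *+ 2)); last first.
  move=> k; split; first exact: measurable_cube.
  by rewrite lebesgue_rV_cube ?ltry// mulrn_wge0.
apply/esym; rewrite -subTset => v _.
exists (Num.bound (enorm v)) => // i; rewrite mxE mulr2n addKr -ltr_norml.
exact: le_lt_trans (ler_coord_enorm v i) (archi_boundP (enorm_ge0 v)).
Qed.

Section sigma_finite_lebesgue_rV.
Variable n : nat.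

(** A copy of [lebesgue_rV] carrying the sigma-finite structure under which the measure of sections
    is a measurable function. *)
Definition sigma_finite_lebesgue_rV : set 'rV[R]_n -> \bar R := lebesgue_rV R n.

HB.instance Definition _ :=
  Measure.copy sigma_finite_lebesgue_rV (lebesgue_rV R n).

HB.instance Definition _ := Measure_isSigmaFinite.Build _ _ _
  sigma_finite_lebesgue_rV (lebesgue_rV_sigma_finite n).

End sigma_finite_lebesgue_rV.

Lemma eball_sub_cube n (x : 'rV[R]_n) t :
    eball x t `<=` cube (x - const_mx t) (t *+ 2).
Proof.
move=> v vx i; rewrite !mxE; have := le_lt_trans (ler_coord_enorm _ i) vx.
by rewrite !mxE ltr_norml mulr2n => /andP[h1 h2]; lra.
Qed.

Lemma lebesgue_rV_eball_lty n (x : 'rV[R]_n) t :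
  (lebesgue_rV R n (eball x t) < +oo)%E.
Proof.
have [t0|t0] := leP t 0.
  by rewrite eball_le0// measure0 ltry.
have h : (lebesgue_rV R n (cube (x - const_mx t) (t *+ 2)) < +oo)%E.
  by rewrite lebesgue_rV_cube ?ltry// mulrn_wge0// ltW.
apply: le_lt_trans h.
by apply: le_measure; rewrite ?inE; [exact: measurable_eball|
  exact: measurable_cube|exact: eball_sub_cube].
Qed.

Lemma fine_lebesgue_rV_eball_le n (x : 'rV[R]_n) t : 0 < t ->
  fine (lebesgue_rV R n (eball x t)) <= (t *+ 2) ^+ n.
Proof.
move=> t0; rewrite -lee_fin fineK ?ge0_fin_numE//;
  last exact: lebesgue_rV_eball_lty.
rewrite -(lebesgue_rV_cube (x - const_mx t)); last by rewrite mulrn_wge0// ltW.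
by apply: le_measure; rewrite ?inE; [exact: measurable_eball|
  exact: measurable_cube|exact: eball_sub_cube].
Qed.

(** Each coordinate of [v - x] lies between [t / (2 n)] and [t / n], and the sum of the coordinates
    bounds the norm. The cube is deliberately off center: all its points are ahead of [x] by
    [t / (2 n)], which yields the drift of [lyapunov_function]. *)
Lemma cube_sub_eball n (x : 'rV[R]_n) t : (0 < n)%N -> 0 < t ->
  cube (x + const_mx (t / (n%:R *+ 2))) (t / (n%:R *+ 2)) `<=` eball x t.
Proof.
move=> n0 t0 v vQ; rewrite /eball /=; apply: (le_lt_trans (enorm_le_sum _)).
have n0' : 0 < n%:R :> R by rewrite ltr0n.
apply: (@lt_le_trans _ _ (\sum_(i < n) (t / n%:R))); last first.
  by rewrite sumr_const card_ord -(mulr_natr (t / n%:R)) divfK// gt_eqF.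
apply: ltr_sum => [|i _].
  by apply/hasP; exists (Ordinal n0); rewrite ?mem_index_enum.
have := vQ i; rewrite !mxE => /andP[h1 h2].
have e : t / n%:R = t / (n%:R *+ 2) + t / (n%:R *+ 2).
  by rewrite -(mulr_natr n%:R 2); field; rewrite gt_eqF.
have d0 : 0 < t / (n%:R *+ 2) by rewrite divr_gt0// mulrn_wgt0.
by rewrite e ltr_norml; lra.
Qed.

Lemma lebesgue_rV_eball_gt0 n (x : 'rV[R]_n) t : (0 < n)%N -> 0 < t ->
  (0 < lebesgue_rV R n (eball x t))%E.
Proof.
move=> n0 t0.
have d0 : 0 < t / (n%:R *+ 2) by rewrite divr_gt0// mulrn_wgt0// ltr0n.
apply: (@lt_le_trans _ _ ((t / (n%:R *+ 2)) ^+ n)%:E).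
  by rewrite lte_fin exprn_gt0.
rewrite -(lebesgue_rV_cube (x + const_mx (t / (n%:R *+ 2)))); last exact: ltW.
by apply: le_measure; rewrite ?inE; [exact: measurable_cube|
  exact: measurable_eball|exact: cube_sub_eball].
Qed.

End lebesgue_rV_cubes.

(** * The law of one round and of the game *)

Section restricted_measure.
Context d (T : measurableType d) (R : realType) (mu : {measure set T ->
  \bar R}).
Local Open Scope ereal_scope.

(** The restriction of [mu] to [D] is the mixture of the measures equal to the Dirac mass at [x] for
    [x] in [D] and to 0 elsewhere. *)
Lemma ge0_integral_mrestr (D : set T) (mD : measurable D) (f : T -> \bar R) :
  (forall x, 0 <= f x) -> measurable_fun setT f ->
  \int[mrestr mu mD]_x f x = \int[mu]_(x in D) f x.
Proof.
move=> f0 mf.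
pose k (x : T) : {measure set T -> \bar R} :=
  if x \in D then (\d_x : {measure set T -> \bar R}) else mzero.
have kE x A : measurable A -> k x A = (\1_(A `&` D) x)%:E.
  move=> mA; rewrite /k indicE in_setI; case: (x \in D) => /=.
    by rewrite diracE andbT.
  by rewrite andbF.
rewrite (integral_mixture (k := k) (P := mu)) //.
- rewrite [RHS]integral_mkcond; apply: eq_integral => x _; rewrite patchE /k.
  case: (x \in D); last by rewrite integral_measure_zero.
  by rewrite integral_dirac// diracT mul1e.
- move=> U mU; rewrite (_ : k ^~ U = EFin \o \1_(U `&` D)).
    by apply/measurable_EFinP; apply: measurable_indic; exact: measurableI.
  by apply/funext => x; rewrite kE.
- move=> A mA; under eq_integral do rewrite kE//.
  by rewrite integral_indic ?setIT//; exact: measurableI.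
Qed.

Lemma inv_fine_ge0 (B : set T) : (0 <= (fine (mu B))^-1)%R.
Proof. by rewrite invr_ge0 fine_ge0. Qed.

Definition uniform_measure (B : set T) (mB : measurable B) :
    {measure set T -> \bar R} :=
  mscale (NngNum (inv_fine_ge0 B)) (mrestr mu mB).

Lemma ge0_integral_uniform_measure B (mB : measurable B) (f : T -> \bar R) :
  (forall x, 0 <= f x) -> measurable_fun setT f ->
  \int[uniform_measure mB]_x f x =
  ((fine (mu B))^-1)%:E * \int[mu]_(x in B) f x.
Proof. by move=> f0 mf; rewrite ge0_integral_mscale// ge0_integral_mrestr. Qed.

Lemma uniform_on_setT B (r : R) : mu B = r%:E -> r != 0%R ->
  uniform_on mu B setT = 1.
Proof. by move=> Br r0; rewrite /uniform_on setTI Br -EFinM mulVf. Qed.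

End restricted_measure.

(** * One round as a probability kernel *)

Section round_kernel.
Context (R : realType) (n : nat) (p eps : R) (Omega : set 'rV[R]_n).
Hypotheses (n_gt0 : (0 < n)%N) (p_gt2 : 2 < p) (eps_gt0 : 0 < eps).
Hypothesis mOmega : measurable Omega.
Variables S1 S2 : strategy n eps.

Let pn_gt0 : 0 < p + n%:R.
Proof. by rewrite addr_gt0 ?ltr0n// (lt_trans _ p_gt2). Qed.

Lemma alpha_gt0 : 0 < alpha n p.
Proof. by rewrite /alpha divr_gt0// subr_gt0. Qed.

Lemma beta_gt0 : 0 < beta n p.
Proof. by rewrite /beta divr_gt0// addr_gt0// ltr0n. Qed.

Lemma alphaDbeta : alpha n p + beta n p = 1.
Proof. by rewrite /alpha /beta; field; rewrite gt_eqF. Qed.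

Let half_alpha_ge0 : 0 <= alpha n p / 2.
Proof. by rewrite divr_ge0// ltW// alpha_gt0. Qed.

Lemma positionS k (h : history R n k.+1) :
  position h = (tnth h.2 ord_max).2.2.
Proof.
case: h => x t; case/tupleP: t => r t; rewrite /position /=.
rewrite (last_map (fun r : round R n => r.2.2)) (tnth_nth r) (last_nth r) /=.
by have -> : size t = k by exact: size_tuple.
Qed.

Lemma measurable_position k :
  measurable_fun setT (@position R n k : history R n k -> 'rV[R]_n).
Proof.
case: k => [|k].
  rewrite (_ : @position R n 0 = fst); first exact: measurable_fst.
  by apply/funext => -[x t]; rewrite (tuple0 t).
rewrite (_ : @position R n k.+1 = (fun r : round R n => r.2.2) \o
  (fun t => tnth t ord_max) \o snd); last first.
  by apply/funext => h /=; rewrite positionS.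
have m1 : measurable_fun setT (fun r : round R n => r.2.2).
  exact: (measurableT_comp measurable_snd measurable_snd).
have m2 : measurable_fun setT (fun t :
  k.+1.-tuple (round R n) => tnth t ord_max).
  exact: measurable_tnth.
exact: (measurableT_comp m1 (measurableT_comp m2 measurable_snd)).
Qed.

Definition noise_round (z : 'rV[R]_n) : round R n := (0%N, (eps, z)).

Lemma measurable_noise_round : measurable_fun setT noise_round.
Proof. exact: measurable_fun_pair. Qed.

Definition player_round c (S : strategy n eps) k (h : history R n k) (t : R) :
  round R n := (c, (t, S k (h, t))).

Lemma measurable_player_round2 c S k :
  measurable_fun setT (fun ht : history R n k * R => player_round c S ht.1
    ht.2).
Proof.
apply: measurable_fun_pair => //.
apply: measurable_fun_pair; first exact: measurable_snd.
rewrite (_ : (fun _ => _) = @next_position _ _ _ S k).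
  exact: measurable_next_position.
by apply/funext => -[].
Qed.

Lemma measurable_player_round c S k (h : history R n k) :
  measurable_fun setT (player_round c S h : measurableTypeR R -> _).
Proof.
exact: (measurableT_comp (@measurable_player_round2 c S k) (measurable_pair1
  h)).
Qed.

Section fixed_history.
Variables (k : nat) (h : history R n k).
Let x := position h.

Definition noise_law : {measure set (round R n) -> \bar R} :=
  image_measure (uniform_measure (lebesgue_rV R n) (measurable_eball x eps))
    measurable_noise_round.

Definition player_law c S : {measure set (round R n) -> \bar R} :=
  image_measure (uniform_measure (@lebesgue_measure R)
    (measurable_itv `[0%R, eps])) (@measurable_player_round c S k h).

(** [round_law] is a bare set function; this sum of images of uniform measures is the same function
    as a measure, against which one can integrate. *)
Definition round_measure : {measure set (round R n) -> \bar R} :=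
  if `[< Omega x >] then
    measure_add (measure_add
      (mscale (NngNum (ltW beta_gt0)) noise_law)
      (mscale (NngNum half_alpha_ge0) (player_law 1 S1)))
      (mscale (NngNum half_alpha_ge0) (player_law 2 S2))
      : {measure set (round R n) -> \bar R}
  else (\d_(noise_round x) : {measure set (round R n) -> \bar R}).

Lemma round_measureE A : round_measure A = round_law p Omega S1 S2 h A.
Proof.
rewrite /round_measure /round_law; case: ifP => // _.
rewrite [LHS]measure_addE; congr (_ + _)%E; exact: measure_addE.
Qed.

End fixed_history.

Lemma lebesgue_measure_steps :
  @lebesgue_measure R `[0, eps]%classic = eps%:E.
Proof. by rewrite lebesgue_measure_itv /= lte_fin eps_gt0 oppr0 adde0. Qed.

Lemma round_law_setT k (h : history R n k) : round_law p Omega S1 S2 h setT =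
    1%E.
Proof.
rewrite /round_law; case: ifPn => _; last by rewrite diracT.
have u1 : uniform_on (lebesgue_rV R n) (eball (position h) eps) setT = 1%E.
  have Bf : lebesgue_rV R n (eball (position h) eps) \is a fin_num.
    by rewrite ge0_fin_numE// lebesgue_rV_eball_lty.
  apply: (uniform_on_setT (esym (fineK Bf))).
  by rewrite fine_eq0// gt_eqF// lebesgue_rV_eball_gt0.
have u2 : uniform_on (@lebesgue_measure R) `[0, eps] setT = 1%E.
  by apply: (uniform_on_setT lebesgue_measure_steps); rewrite gt_eqF.
rewrite [X in (_ * X + _ + _)%E](_ : _ = 1%E)// [X in (_ + _ * X + _)%E](_ :
  _ = 1%E)//.
rewrite [X in (_ + _ + _ * X)%E](_ : _ = 1%E)// !mule1 -!EFinD.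
congr EFin; have := alphaDbeta; lra.
Qed.

(** The ball [eball x eps] is the section at [x] of the measurable set of pairs at distance less
    than [eps], so the measures involved depend measurably on [x]. *)
Lemma measurable_uniform_on_eball (A : set 'rV[R]_n) : measurable A ->
  measurable_fun setT
    (fun x : 'rV[R]_n => uniform_on (lebesgue_rV R n) (eball x eps) A).
Proof.
move=> mA; pose mu := @sigma_finite_lebesgue_rV R n.
pose E := [set z : 'rV[R]_n * 'rV[R]_n | enorm (z.2 - z.1) < eps].
have mE : measurable E.
  rewrite -[X in measurable X]setTI.
  rewrite (_ : E = (fun z : 'rV[R]_n * 'rV[R]_n =>
    enorm (z.2 - z.1)) @^-1` `]-oo, eps[%classic).
    by apply: measurable_fun_enormB => //; exact: measurable_snd.
  by apply/seteqP; split => z /=; rewrite in_itv.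
have m0 : measurable_fun setT
    (fun x : 'rV[R]_n => lebesgue_rV R n (eball x eps)).
  rewrite (_ : (fun _ => _) = mu \o xsection E);
    first exact: measurable_fun_xsection.
  by apply/funext => x; rewrite /= xsectionE.
pose E0 := E `&` (snd @^-1` A).
have mE0 : measurable E0.
  apply: measurableI => //; rewrite -[X in measurable X]setTI.
  exact: measurable_snd.
have m1 : measurable_fun setT (fun x : 'rV[R]_n =>
    lebesgue_rV R n (A `&` eball x eps)).
  rewrite (_ : (fun _ => _) = mu \o xsection E0);
    first exact: measurable_fun_xsection.
  by apply/funext => x; rewrite /= xsectionE setIC.
rewrite /uniform_on; apply: emeasurable_funM => //; apply/measurable_EFinP.
under eq_fun do rewrite -powR_inv1 ?fine_ge0//.
apply: (measurableT_comp (measurable_powR _)).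
exact: (measurableT_comp (fine_measurable measurableT) m0).
Qed.

Lemma measurable_round_law k (A : set (round R n)) : measurable A ->
  measurable_fun setT (fun h : history R n k => round_law p Omega S1 S2 h A).
Proof.
move=> mA.
(* The steps [t] leading into [A] form the section at [h] of a measurable set of pairs, because
   strategies are jointly measurable in history and step. *)
have mplay c S : measurable_fun setT (fun h : history R n k =>
    @lebesgue_measure R ([set t | A (player_round c S h t)] `&` `[0, eps])).
  pose G := [set ht : history R n k * R | A (player_round c S ht.1 ht.2)] `&`
    (snd @^-1` `[0, eps]%classic).
  have mG : measurable G.
    apply: measurableI; rewrite -[X in measurable X]setTI.
      exact: (@measurable_player_round2 c S k measurableT A mA).
    by apply: measurable_snd => //; exact: measurable_itv.
  rewrite (_ : (fun _ => _) = @lebesgue_measure R \o xsection G).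
    exact: measurable_fun_xsection.
  by apply/funext => h; rewrite /= xsectionE.
rewrite /round_law; apply: measurable_fun_ifT.
- apply: (measurable_fun_bool true); rewrite setTI.
  rewrite (_ : _ @^-1` _ = @position R n k @^-1` Omega).
    by rewrite -[X in measurable X]setTI; exact: measurable_position.
  by apply/seteqP; split => h /= /asboolP.
- apply: emeasurable_funD; [apply: emeasurable_funD|];
    apply: measurable_funeM.
  + apply: (measurableT_comp (measurable_uniform_on_eball _)).
      rewrite -[X in measurable X]setTI.
      exact: (@measurable_noise_round measurableT A mA).
    exact: measurable_position.
  + by rewrite /uniform_on; apply: measurable_funeM; exact: mplay.
  + by rewrite /uniform_on; apply: measurable_funeM; exact: mplay.
- rewrite (_ : (fun _ => _) = (fun r => \d_r A) \o noise_round \o @position R n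
    k).
    apply: measurableT_comp; last exact: measurable_position.
    apply: measurableT_comp; last exact: measurable_noise_round.
    exact: measurable_fun_dirac.
  by [].
Qed.

Section round_kernel.
Variables (x0 : 'rV[R]_n) (k : nat).

Definition round_kernel (t : k.-tuple (round R n)) :
  {measure set (round R n) -> \bar R} := round_measure (x0, t).

Let measurable_kernel U : measurable U ->
  measurable_fun setT (round_kernel ^~ U).
Proof.
move=> mU; under eq_fun do rewrite /round_kernel round_measureE.
exact: (measurableT_comp (@measurable_round_law k U mU) (measurable_pair1 x0)).
Qed.

HB.instance Definition _ :=
  isKernel.Build _ _ _ _ _ round_kernel measurable_kernel.

Let prob t : round_kernel t setT = 1%E.
Proof. by rewrite /round_kernel round_measureE round_law_setT. Qed.

HB.instance Definition _ :=
  Kernel_isProbability.Build _ _ _ _ _ round_kernel prob.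

End round_kernel.

Lemma exists_game_law (x0 : 'rV[R]_n) :
  exists P : probability (trajectory R n) R, is_game_law p Omega x0 S1 S2 P.
Proof.
exists (tulcea_law (@round_kernel x0) (fun=> point)) => k B A mB mA.
rewrite [LHS](tulcea_lawP _ _ mB mA); apply: eq_integral => w _.
by rewrite /= /round_kernel round_measureE.
Qed.

Lemma game_lawP (x0 : 'rV[R]_n) :
  is_game_law p Omega x0 S1 S2 (game_law p Omega x0 S1 S2).
Proof. exact: (xgetPex _ (exists_game_law x0)). Qed.

End round_kernel.

(** * Averages and suprema over balls *)

Section bounded_measurable.
Context d (T : measurableType d) (R : realType).
Implicit Types f g : T -> R.

(** Such functions are integrable on sets of finite measure for every measure, so that this one
    condition suffices for the uniform averages and for the means along the game. *)
Definition bounded_measurable f :=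
  measurable_fun setT f /\ exists M, forall x, `|f x| <= M.

Lemma bounded_measurable_cst (r : R) : bounded_measurable (cst r).
Proof. by split => //; exists `|r|. Qed.

Lemma bounded_measurableD f g : bounded_measurable f -> bounded_measurable g ->
  bounded_measurable (fun x => f x + g x).
Proof.
move=> [mf [M fM]] [mg [N gN]]; split; first exact: measurable_funD.
by exists (M + N) => x; rewrite (le_trans (ler_normD _ _))// lerD.
Qed.

Lemma bounded_measurableN f : bounded_measurable f ->
  bounded_measurable (fun x => - f x).
Proof.
move=> [mf [M fM]]; split; first exact: measurableT_comp.
by exists M => x; rewrite normrN.
Qed.

Lemma bounded_measurableZ f (a : R) : bounded_measurable f ->
  bounded_measurable (fun x => a * f x).
Proof.
move=> [mf [M fM]]; split.
  by apply: measurable_funM => //; exact: measurable_cst.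
by exists (`|a| * M) => x; rewrite normrM ler_wpM2l.
Qed.

Lemma bounded_measurable_indic (A : set T) : measurable A ->
  bounded_measurable (\1_A : T -> R).
Proof.
move=> mA; split; first exact: measurable_indic.
by exists 1 => x; rewrite indicE; case: (_ \in _); rewrite ?normr1 ?normr0.
Qed.

Lemma bounded_measurable_integrable (mu : {measure set T -> \bar R}) B f :
  measurable B -> (mu B < +oo)%E -> bounded_measurable f ->
  mu.-integrable B (EFin \o f).
Proof.
move=> mB Bfin [mf [M fM]]; apply: measurable_bounded_integrable => //.
  exact: measurable_funTS.
exists M; split; first exact: num_real.
by move=> N MN x _; exact: le_trans (fM x) (ltW MN).
Qed.

Definition average (mu : {measure set T -> \bar R}) (B : set T) f :=
  (fine (mu B))^-1 * \int[mu]_(x in B) f x.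

Section average.
Variables (mu : {measure set T -> \bar R}) (B : set T) (r : R).
Hypotheses (mB : measurable B) (muB : mu B = r%:E) (r_gt0 : 0 < r).

Let Bfin : (mu B < +oo)%E.
Proof. by rewrite muB ltry. Qed.

Lemma average_cst c : average mu B (cst c) = c.
Proof. by rewrite /average Rintegral_cst// muB mulrCA mulVf ?mulr1// gt_eqF.
  Qed.

Lemma averageD f g : bounded_measurable f -> bounded_measurable g ->
  average mu B (fun x => f x + g x) = average mu B f + average mu B g.
Proof.
by move=> bf bg; rewrite /average RintegralD ?mulrDr//;
  exact: bounded_measurable_integrable.
Qed.

Lemma average_le f g : bounded_measurable f -> bounded_measurable g ->
  (forall x, B x -> f x <= g x) -> average mu B f <= average mu B g.
Proof.
move=> bf bg fg; rewrite /average ler_pM2l; last by rewrite muB invr_gt0.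
by apply: le_Rintegral => //; exact: bounded_measurable_integrable.
Qed.

Lemma averageZ f (a : R) : bounded_measurable f ->
  average mu B (fun x => a * f x) = a * average mu B f.
Proof.
move=> bf; rewrite /average RintegralZl//; first by rewrite mulrCA.
exact: bounded_measurable_integrable.
Qed.

Lemma averageN f : bounded_measurable f ->
  average mu B (fun x => - f x) = - average mu B f.
Proof.
move=> bf; rewrite -mulN1r -averageZ//.
by congr (average mu B _); apply/funext => x; rewrite mulN1r.
Qed.

Lemma averageE f : bounded_measurable f ->
  ((fine (mu B))^-1%:E * \int[mu]_(x in B) (f x)%:E = (average mu B f)%:E)%E.
Proof.
move=> bf; rewrite /average EFinM fineK//.
exact/integrable_fin_num/bounded_measurable_integrable.
Qed.

End average.

End bounded_measurable.

Lemma bounded_measurable_comp d d' (T : measurableType d)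
    (T' : measurableType d') (R : realType) (phi : T' -> T) (f : T -> R) :
  measurable_fun setT phi -> bounded_measurable f ->
  bounded_measurable (f \o phi).
Proof.
move=> mphi [mf [M fM]]; split; first exact: measurableT_comp.
by exists M => x /=.
Qed.

Lemma bounded_measurable_play (R : realType) (n : nat) (eps : R)
    (S : strategy n eps) k (h : history R n k) (g : 'rV[R]_n -> R) :
  bounded_measurable g ->
  @bounded_measurable _ (measurableTypeR R) R (fun t => g (S k (h, t))).
Proof.
(* The move is read off as the last component of a round; the outcome number 1 is arbitrary. *)
move=> bg; exact: (bounded_measurable_comp (measurableT_comp
  (measurableT_comp measurable_snd measurable_snd)
  (@measurable_player_round R n eps 1 S k h)) bg).
Qed.

Section round_integral.
Context (R : realType) (n : nat) (p eps : R) (Omega : set 'rV[R]_n).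
Hypotheses (n_gt0 : (0 < n)%N) (p_gt2 : 2 < p) (eps_gt0 : 0 < eps).

Definition ball_average (x : 'rV[R]_n) (g : 'rV[R]_n -> R) : R :=
  average (lebesgue_rV R n) (eball x eps) g.

Definition step_average (g : R -> R) : R :=
  average (@lebesgue_measure R) `[0, eps]%classic g.

Lemma ball_measure (x : 'rV[R]_n) :
  lebesgue_rV R n (eball x eps) = (fine (lebesgue_rV R n (eball x eps)))%:E.
Proof. by rewrite fineK// ge0_fin_numE// lebesgue_rV_eball_lty. Qed.

Lemma ball_measure_gt0 (x : 'rV[R]_n) :
  0 < fine (lebesgue_rV R n (eball x eps)).
Proof. by rewrite fine_gt0// lebesgue_rV_eball_lty lebesgue_rV_eball_gt0. Qed.

Variables S1 S2 : strategy n eps.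

Definition round_mean k (h : history R n k) (f : round R n -> R) : R :=
  if `[< Omega (position h) >] then
    beta n p * ball_average (position h) (f \o noise_round eps)
    + alpha n p / 2 * step_average (f \o player_round 1 S1 h)
    + alpha n p / 2 * step_average (f \o player_round 2 S2 h)
  else f (noise_round eps (position h)).

Lemma ge0_integral_round_measure k (h : history R n k) (f : round R n -> R) :
  bounded_measurable f -> (forall r, 0 <= f r) ->
  (\int[round_measure Omega n_gt0 p_gt2 S1 S2 h]_r (f r)%:E =
   (round_mean h f)%:E)%E.
Proof.
move=> bf f0; have mf : measurable_fun setT (EFin \o f).
  by apply/measurable_EFinP; exact: bf.1.
have f0' (r : round R n) : (0 <= (f r)%:E)%E by rewrite lee_fin.
rewrite /round_measure /round_mean; case: ifPn => _; last first.
  by rewrite integral_dirac// diracT mul1e.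
have b0 := bounded_measurable_comp (@measurable_noise_round R n eps) bf.
have b1 (S : strategy n eps) c :=
  bounded_measurable_comp (@measurable_player_round R n eps c S k h) bf.
have I0 : (\int[noise_law eps h]_r (f r)%:E =
    (ball_average (position h) (f \o noise_round eps))%:E)%E.
  rewrite /noise_law [LHS]ge0_integral_pushforward//;
    last exact: measurable_noise_round.
  rewrite preimage_setT ge0_integral_uniform_measure; last 2 first.
  - by move=> z; exact: f0'.
  - by apply/measurable_EFinP; exact: b0.1.
  exact: (averageE (measurable_eball (position h) eps) (ball_measure _) b0).
have I1 (S : strategy n eps) c : (\int[player_law h c S]_r (f r)%:E =
    (step_average (f \o player_round c S h))%:E)%E.
  rewrite /player_law [LHS]ge0_integral_pushforward//;
    last exact: measurable_player_round.
  rewrite preimage_setT ge0_integral_uniform_measure; last 2 first.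
  - by move=> z; exact: f0'.
  - by apply/measurable_EFinP; exact: (b1 S c).1.
  exact: (averageE _ (lebesgue_measure_steps eps_gt0) (b1 S c)).
transitivity ((beta n p)%:E * (\int[noise_law eps h]_r (f r)%:E) +
    (alpha n p / 2)%:E * (\int[player_law h 1 S1]_r (f r)%:E) +
    (alpha n p / 2)%:E * (\int[player_law h 2 S2]_r (f r)%:E))%E; last first.
  by rewrite I0 !I1.
etransitivity; first by apply: ge0_integral_measure_add => // r _; exact: f0'.
congr (_ + _)%E; last by apply: ge0_integral_mscale => // r _; exact: f0'.
etransitivity; first by apply: ge0_integral_measure_add => // r _; exact: f0'.
by congr (_ + _)%E; apply: ge0_integral_mscale => // r _; exact: f0'.
Qed.

(** The weights of the three outcomes add up to 1. This lets bounded functions be shifted to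
    nonnegative ones, for which the integral against a mixture is computed. *)
Lemma round_meanD_cst k (h : history R n k) (f : round R n -> R) (M : R) :
  bounded_measurable f ->
  round_mean h (fun r => f r + M) = round_mean h f + M.
Proof.
move=> bf; rewrite /round_mean; case: ifPn => // _.
have b0 := bounded_measurable_comp (@measurable_noise_round R n eps) bf.
have b1 (S : strategy n eps) c :=
  bounded_measurable_comp (@measurable_player_round R n eps c S k h) bf.
have E0 x : ball_average x ((fun r => f r + M) \o noise_round eps) =
    ball_average x (f \o noise_round eps) + M.
  rewrite /ball_average -[in RHS](average_cst (measurable_eball x eps)
    (ball_measure x) (ball_measure_gt0 x) M).
  by apply: (averageD _ (ball_measure x)) => //;
    [exact: measurable_eball|exact: bounded_measurable_cst].
have E1 (S : strategy n eps) c :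
  step_average ((fun r => f r + M) \o player_round c S h) =
    step_average (f \o player_round c S h) + M.
  rewrite /step_average -[in RHS](average_cst _ (lebesgue_measure_steps
    eps_gt0) eps_gt0 M)//.
  by apply: (averageD _ (lebesgue_measure_steps eps_gt0)) => //;
    [exact: b1|exact: bounded_measurable_cst].
rewrite E0 !E1 !mulrDr; have := alphaDbeta n_gt0 p_gt2.
by set a := alpha n p; set b := beta n p => ab; nra.
Qed.

End round_integral.

(** * Borel measurability of suprema over open balls *)

Section suprema_over_balls.
Context (R : realType) (n : nat).
Implicit Types (u v : 'rV[R]_n -> R) (x : 'rV[R]_n) (B : set 'rV[R]_n).

Definition rational_box (c : n.-tuple rat * rat) : set 'rV[R]_n :=
  [set v | forall i, `|ratr (tnth c.1 i) - v ord0 i| < ratr c.2].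

Lemma rational_box_basis (U : set 'rV[R]_n) y : open U -> U y ->
  exists2 c, rational_box c y & rational_box c `<=` U.
Proof.
move=> oU Uy; have : nbhs y U by exact: open_nbhs_nbhs.
move=> /nbhs_ballP[e /= e0 eU].
have [q [q0 qe]] : exists q : rat, 0 < ratr q :> R /\ ratr q < e / 2.
  have [|q] := @rat_in_itvoo R 0 (e / 2); first by rewrite divr_gt0.
  by rewrite in_itv /= => /andP[]; exists q.
have /choice[c cP] : forall i, exists a : rat, `|ratr a - y ord0 i| < ratr q.
  move=> i.
  have [|a] := @rat_in_itvoo R (y ord0 i - ratr q) (y ord0 i + ratr q).
    by rewrite ltrD2l gtrN.
  by rewrite in_itv /= -ltr_distl => ?; exists a.
exists ([tuple c i | i < n], q) => [i|v bv].
  by rewrite /= tnth_mktuple.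
apply: eU; split => // i j; rewrite /ball /= ord1.
have := bv j; have := cP j; rewrite /= tnth_mktuple => h1 h2.
rewrite -(subrKA (ratr (c j))) (le_lt_trans (ler_normD _ _))//.
by rewrite (splitr e) ltrD// ?(lt_trans _ qe)// distrC.
Qed.

Definition bounded_by (M : R) u := forall x, `|u x| <= M.

Lemma bounded_by_has_sup M u B : bounded_by M u -> B !=set0 ->
  has_sup (u @` B).
Proof.
move=> uM [y By]; split; first by exists (u y), y.
by exists M => _ [z _ <-]; exact: le_trans (ler_norm _) (uM z).
Qed.

Lemma le_sup_image M u B y : bounded_by M u -> B y -> u y <= sup (u @` B).
Proof.
move=> uM By; apply: ub_le_sup; last by exists y.
by apply: (bounded_by_has_sup uM _).2; exists y.
Qed.

Lemma sup_image_le u B a : B !=set0 -> (forall y, B y -> u y <= a) ->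
  sup (u @` B) <= a.
Proof.
move=> [y By] ua; apply: ge_sup; first by exists (u y), y.
by move=> _ [z Bz <-]; exact: ua.
Qed.

Lemma inf_imageE u B : inf (u @` B) = - sup ((fun y => - u y) @` B).
Proof. by rewrite /inf; congr (- sup _); rewrite image_comp. Qed.

Lemma sup_image_bounded M u B : 0 <= M -> bounded_by M u -> `|sup (u @` B)| <=
    M.
Proof.
move=> M0 uM; have [->|/set0P[y By]] := eqVneq B set0.
  by rewrite image_set0 sup0 normr0.
rewrite ler_norml; apply/andP; split.
  apply: le_trans (le_sup_image uM By).
  by have := uM y; rewrite ler_norml => /andP[].
apply: sup_image_le; first by exists y.
by move=> z _; exact: le_trans (ler_norm _) (uM z).
Qed.

Lemma sup_image_close M u v B e : bounded_by M v -> 0 <= e ->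
  (forall y, B y -> u y <= v y + e) -> sup (u @` B) <= sup (v @` B) + e.
Proof.
move=> vM e0 uv; have [->|/set0P[y By]] := eqVneq B set0.
  by rewrite !image_set0 sup0 add0r.
apply: sup_image_le; first by exists y.
by move=> z Bz; apply: (le_trans (uv z Bz)); rewrite lerD2r (le_sup_image vM).
Qed.

(* [D] runs through points of every rational box at which [u] is arbitrarily
   close to its supremum over the box. *)
Lemma exists_dense_points M u : bounded_by M u -> exists D : nat -> 'rV[R]_n,
  forall U y e, open U -> U y -> 0 < e -> exists i,
    U (D i) /\ u y - e < u (D i).
Proof.
move=> uM.
have /choice[d dP] : forall z : (n.-tuple rat * rat) * nat, exists d,
    rational_box z.1 !=set0 ->
    rational_box z.1 d /\ sup (u @` rational_box z.1) - z.2.+1%:R^-1 < u d.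
  move=> [c k] /=; have [c0|] := pselect (rational_box c !=set0);
    last by exists 0.
  have k0 : 0 < k.+1%:R^-1 :> R by rewrite invr_gt0.
  have [_ [y cy <-] yk] := sup_adherent k0 (bounded_by_has_sup uM c0).
  by exists y.
exists (fun i => if unpickle i is Some z then d z else 0).
move=> U y e oU Uy e0.
have [c cy cU] := rational_box_basis oU Uy.
have [k _ /(_ _ (leqnn k)) ke] := near_infty_natSinv_lt (PosNum e0).
have [cd kd] := dP (c, k) (ex_intro _ y cy).
exists (pickle (c, k)); rewrite pickleK; split; first exact: cU.
apply: le_lt_trans kd; rewrite /= lerB//; last exact: ltW.
exact: le_sup_image uM cy.
Qed.

Lemma eball_nonempty x t : (eball x t !=set0) <-> 0 < t.
Proof.
split=> [[y]|t0]; first exact: le_lt_trans (enorm_ge0 _).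
by exists x; rewrite /eball /= subrr enorm0.
Qed.

(** A supremum over an open ball exceeds [a] iff some [D i] in the ball has [u (D i) > a]: a
    countable union of conditions on center and radius only. Nothing but boundedness is asked of
    [u]. *)
Lemma measurable_sup_eball d (Y : measurableType d) (f : Y -> 'rV[R]_n)
    (g : Y -> R) M u : bounded_by M u ->
  measurable_fun setT f -> measurable_fun setT g ->
  measurable_fun setT (fun y => sup (u @` eball (f y) (g y))).
Proof.
move=> uM mf mg; have [D DP] := exists_dense_points uM.
apply: (measurability _ (RGenOInfty.measurableE R)) => //.
move=> _ [_ [a ->] <-]; rewrite setTI.
pose A i := [set y : Y | u (D i) > a] `&` [set y | enorm (D i - f y) < g y].
have mA i : measurable (A i).
  have ml : measurable_fun setT (fun y => (enorm (D i - f y) < g y)%R).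
    apply: measurable_fun_ltr => //.
    by apply: (measurable_fun_enormB (f := cst (D i))).
  apply: measurableI; last first.
    rewrite -[X in measurable X]setTI.
    exact: (ml measurableT [set true]).
  case: (ltP a (u (D i))) => _.
    by rewrite (_ : [set _ | _] = setT)//; apply/seteqP; split.
  by rewrite (_ : [set _ | _] = set0)//; apply/seteqP; split.
(* For a radius at most 0 the ball is empty and its supremum is 0 by convention, which exceeds [a]
   iff [a < 0]. *)
rewrite (_ : _ @^-1` _ =
    (\bigcup_i A i) `|` [set y | g y <= 0 /\ a < 0]).
  apply: measurableU; first exact: bigcupT_measurable.
  have mle : measurable [set y | g y <= 0].
    rewrite -[X in measurable X]setTI.
    have ml : measurable_fun setT (fun y => (g y <= 0)%R).
      exact: measurable_fun_ler.
    exact: (ml measurableT [set true]).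
  case: (ltP a 0) => _.
    by rewrite (_ : [set _ | _] = [set y | g y <= 0])//; apply/seteqP;
      split => y //= [].
  by rewrite (_ : [set _ | _] = set0)//; apply/seteqP; split => y //= [].
apply/seteqP; split => y /=; rewrite in_itv /= andbT.
  have [gy|gy] := ltP 0 (g y); last first.
    by rewrite eball_le0// image_set0 sup0 => a0; right.
  have ne : eball (f y) (g y) !=set0 by apply/eball_nonempty.
  move=> ay; left.
  have e0 : 0 < sup (u @` eball (f y) (g y)) - a by rewrite subr_gt0.
  have [_ [z Bz <-]] := sup_adherent e0 (bounded_by_has_sup uM ne).
  rewrite subKr => az.
  have az0 : 0 < u z - a by rewrite subr_gt0.
  have [i [Bi ui]] := DP _ z _ (@open_eball R n (f y) (g y)) Bz az0.
  by exists i => //; split => //=; move: ui; rewrite subKr.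
move=> [[i _ [/= ai iB]]|[gy a0]].
  by apply: (lt_le_trans ai); exact: le_sup_image uM iB.
by rewrite eball_le0// image_set0 sup0.
Qed.

End suprema_over_balls.

(** * The dynamic programming operator *)

Section lyapunov.
Context (R : realType) (n : nat) (p eps : R) (Omega : set 'rV[R]_n).
Hypotheses (n_gt0 : (0 < n)%N) (p_gt2 : 2 < p) (eps_gt0 : 0 < eps).
Hypothesis bOmega : bounded_set Omega.

Lemma ler_coord_mx_norm (x : 'rV[R]_n) i : `|x ord0 i| <= `|x|.
Proof.
by rewrite /Num.Def.normr /= mx_normrE; apply: (le_bigmax _ _ (ord0, i)).
Qed.

Lemma average_indic (B Q : set 'rV[R]_n) r a : measurable B -> measurable Q ->
  Q `<=` B -> lebesgue_rV R n B = r%:E ->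
  average (lebesgue_rV R n) B (fun x => a * \1_Q x) =
  a * (fine (lebesgue_rV R n Q) / fine (lebesgue_rV R n B)).
Proof.
move=> mB mQ QB Br.
have Bfin : (lebesgue_rV R n B < +oo)%E by rewrite Br ltry.
rewrite /average RintegralZl//; last first.
  by apply: bounded_measurable_integrable => //;
    exact: bounded_measurable_indic.
rewrite /Rintegral integral_indic// setIidl// mulrC -mulrA; congr (_ * _).
Qed.

(* A large exponential of the first coordinate: the noise moves the token
   forward by a fixed amount with a fixed probability, which compensates
   whatever the players do. *)
Lemma lyapunov_function : exists (V : 'rV[R]_n -> R) (C c : R),
  [/\ bounded_measurable V, forall x, 0 <= V x <= C, 0 < c, c <= C &
      forall x, Omega x -> V x + c <= beta n p * ball_average eps x V].
Proof.
pose i0 := Ordinal n_gt0.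
have [L0 [L0_ge0 HL]] : exists L0, 0 <= L0 /\
    forall x, Omega x -> `|x ord0 i0| <= L0.
  have [M [_ HM]] := bOmega; exists (`|M| + 1); split;
    first by rewrite addr_ge0.
  move=> x Ox; apply: le_trans (ler_coord_mx_norm x i0) _.
  by apply: HM => //; rewrite ltr_pwDr// ler_norm.
(* The truncation makes [V] bounded; the margin [eps] keeps it from interfering when the token moves
   forward by [de <= eps] from a point of [Omega]. *)
pose L := L0 + eps.
pose de := eps / (n%:R *+ 2).
have n0 : 0 < n%:R :> R by rewrite ltr0n.
have de0 : 0 < de by rewrite divr_gt0// mulrn_wgt0.
(* A lower bound for the fraction of the ball filled by the forward cube of side [de], since the
   ball has measure at most [(2 eps) ^ n]. *)
pose th := de ^+ n / (eps *+ 2) ^+ n.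
have th0 : 0 < th by rewrite divr_gt0// exprn_gt0// mulrn_wgt0.
have b0 : 0 < beta n p := beta_gt0 n_gt0 p_gt2.
(* Chosen so that [beta * th * (ka * de) = 2]; as [expR y >= 1 + y], the noise alone then at least
   doubles [V]. *)
pose ka := 2 / (beta n p * th * de).
have ka0 : 0 < ka by apply: divr_gt0 => //; do 2 apply: mulr_gt0 => //.
pose V (y : 'rV[R]_n) := expR (ka * Num.min (y ord0 i0) L).
have V0 y : 0 < V y by exact: expR_gt0.
have VC y : V y <= expR (ka * L).
  by rewrite ler_expR ler_pM2l// ge_min lexx orbT.
have bV : bounded_measurable V.
  split; last by exists (expR (ka * L)) => y; rewrite gtr0_norm.
  apply: measurableT_comp => //; apply: measurable_funM => //.
  apply: measurable_minr => //; exact: measurable_coord.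
exists V, (expR (ka * L)), (expR (- (ka * L0))); split => //.
- by move=> x; rewrite VC ltW.
- exact: expR_gt0.
- rewrite ler_expR -mulrN ler_pM2l//.
  by rewrite /L (le_trans (y := 0)) ?oppr_le0// addr_ge0// ltW.
move=> x Ox.
have Vx : V x = expR (ka * x ord0 i0).
  rewrite /V min_l// (le_trans (ler_norm _))// (le_trans (HL x Ox))//.
  by rewrite lerDl ltW.
have cV : expR (- (ka * L0)) <= V x.
  rewrite Vx ler_expR -mulrN ler_pM2l//.
  by have := HL x Ox; rewrite ler_norml => /andP[].
(* The constant [c = expR (- ka * L0)] is a lower bound of [V] on [Omega], so that doubling [V] is
   enough. *)
apply: (@le_trans _ _ (V x * 2)); first by rewrite mulr_natr mulr2n lerD2l.
pose Q := cube (x + const_mx de) de.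
have mQ : measurable Q by exact: measurable_cube.
have QB : Q `<=` eball x eps by exact: cube_sub_eball.
pose a := V x * expR (ka * de).
have a0 : 0 < a by rewrite mulr_gt0// expR_gt0.
have bQ : bounded_measurable (fun y => a * \1_Q y).
  split; first by apply: measurable_funM => //; exact: measurable_indic.
  exists a => y; rewrite normrM (gtr0_norm a0) indicE.
  by case: (_ \in _); rewrite ?normr1 ?normr0 ?mulr1 ?mulr0// ltW.
have avg : a * th <= ball_average eps x V.
  apply: (@le_trans _ _ (average (lebesgue_rV R n) (eball x eps) (fun y => a *
    \1_Q y))).
    rewrite (average_indic _ (measurable_eball x eps) mQ QB (ball_measure eps
      x)).
    rewrite ler_pM2l// /th lebesgue_rV_cube; last exact: ltW.
    rewrite ler_pM2l ?exprn_gt0// lef_pV2 ?posrE ?exprn_gt0 ?mulrn_wgt0//.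
      exact: fine_lebesgue_rV_eball_le.
    exact: ball_measure_gt0.
  apply: (average_le (measurable_eball x eps) (ball_measure eps x)) => //.
    exact: ball_measure_gt0.
  move=> y By; rewrite indicE.
  have [/set_mem Qy|_] := boolP (y \in Q); last by rewrite mulr0 ltW.
  rewrite mulr1 /a Vx -expRD ler_expR -mulrDr ler_pM2l//.
  have := Qy i0; rewrite !mxE => /andP[xy _].
  have xL : x ord0 i0 <= L0 by apply: le_trans (HL x Ox); exact: ler_norm.
  have deE : de <= eps.
    have n1 : 1 <= n%:R :> R by rewrite ler1n.
    by rewrite /de ler_pdivrMr ?mulrn_wgt0// mulr2n ler_pMr//; lra.
  by rewrite le_min ltW//= /L lerD.
apply: (@le_trans _ _ (beta n p * (a * th))); last by rewrite ler_pM2l.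
have h : 2 <= beta n p * th * expR (ka * de).
  apply: (@le_trans _ _ (beta n p * th * (ka * de))).
    rewrite /ka le_eqVlt; apply/orP; left; apply/eqP; field.
    by rewrite !gt_eqF.
  have e := expR_ge1Dx (ka * de).
  by apply: ler_wpM2l; [exact: ltW (mulr_gt0 b0 th0)|lra].
by rewrite /a; have := V0 x; nra.
Qed.

End lyapunov.

(** * Contraction and fixed point of the dynamic programming operator *)

Section dynamic_programming.
Context (R : realType) (n : nat) (p eps : R) (Omega : set 'rV[R]_n).
Hypotheses (n_gt0 : (0 < n)%N) (p_gt2 : 2 < p) (eps_gt0 : 0 < eps).
Hypothesis mOmega : measurable Omega.
Variables (G : 'rV[R]_n -> R) (M : R).
Hypotheses (mG : measurable_fun setT G) (GM : bounded_by M G).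
Implicit Types (u v : 'rV[R]_n -> R) (x : 'rV[R]_n).

Let M_ge0 : 0 <= M.
Proof. exact: le_trans (normr_ge0 _) (GM 0). Qed.

Definition sup_inf u (x : 'rV[R]_n) (t : R) : R :=
  sup (u @` eball x t) + inf (u @` eball x t).

Definition value_step u (x : 'rV[R]_n) : R :=
  if `[< Omega x >] then
    alpha n p / 2 * step_average eps (sup_inf u x)
    + beta n p * ball_average eps x u
  else G x.

Lemma value_step_dpp u x : Omega x -> value_step u x = u x -> dpp p eps u x.
Proof.
move=> Ox; rewrite /value_step asboolT// /dpp => <-; congr (_ + _).
have -> : alpha n p / (2 * eps) = alpha n p / 2 * eps^-1 by rewrite invfM mulrA.
rewrite -[RHS]mulrA; congr (_ * _); rewrite /step_average /average.
congr (_ * _); congr (_^-1).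
exact: (congr1 fine (lebesgue_measure_steps eps_gt0)).
Qed.

Let a_gt0 := alpha_gt0 n_gt0 p_gt2.
Let b_gt0 := beta_gt0 n_gt0 p_gt2.
Let ab1 := alphaDbeta n_gt0 p_gt2.

Lemma measurable_sup_inf d (Y : measurableType d) (f : Y -> 'rV[R]_n)
    (g : Y -> R) N u : bounded_by N u ->
  measurable_fun setT f -> measurable_fun setT g ->
  measurable_fun setT (fun y => sup_inf u (f y) (g y)).
Proof.
move=> uN mf mg; rewrite /sup_inf; apply: measurable_funD.
  exact: measurable_sup_eball uN mf mg.
under eq_fun do rewrite inf_imageE.
apply: measurableT_comp => //; apply: (measurable_sup_eball (M := N)) => // x.
by rewrite normrN.
Qed.

Lemma sup_inf_bounded N u x t : bounded_by N u -> `|sup_inf u x t| <= N *+ 2.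
Proof.
move=> uN; have N0 : 0 <= N := le_trans (normr_ge0 _) (uN 0).
rewrite /sup_inf (le_trans (ler_normD _ _))// mulr2n lerD//.
  exact: sup_image_bounded.
rewrite inf_imageE normrN; apply: sup_image_bounded => // y.
by rewrite normrN.
Qed.

Lemma bounded_measurable_sup_inf N u x : bounded_by N u ->
  @bounded_measurable _ (measurableTypeR R) R (sup_inf u x).
Proof.
move=> uN; split; last by exists (N *+ 2) => t; exact: sup_inf_bounded.
exact: (@measurable_sup_inf _ (measurableTypeR R) (cst x) id N).
Qed.

Lemma sup_inf_le N u v x t e : bounded_by N u -> bounded_by N v -> 0 <= e ->
  (forall y, u y <= v y + e) -> sup_inf u x t <= sup_inf v x t + e *+ 2.
Proof.
move=> uN vN e0 uv; rewrite /sup_inf !inf_imageE.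
have h1 := sup_image_close (B := eball x t) vN e0 (fun y _ => uv y).
have h2 : sup ((fun y => - v y) @` eball x t) <=
    sup ((fun y => - u y) @` eball x t) + e.
  apply: (sup_image_close (M := N)) => // y; first by rewrite normrN.
  by move=> _; have := uv y; lra.
by rewrite mulr2n; lra.
Qed.

Lemma step_average_cst c : step_average eps (cst c) = c.
Proof. exact: (average_cst _ (lebesgue_measure_steps eps_gt0)). Qed.

Lemma ball_average_cst x c : ball_average eps x (cst c) = c.
Proof.
exact: (average_cst (measurable_eball x eps) (ball_measure eps x)
  (ball_measure_gt0 n_gt0 eps_gt0 x)).
Qed.

(** Step 0 is discarded as a null set: there the ball is empty, suprema take a default value and
    strategies are unconstrained, so no comparison can be expected. *)
Lemma step_average_le (f g : R -> R) :
  @bounded_measurable _ (measurableTypeR R) R f ->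
  @bounded_measurable _ (measurableTypeR R) R g ->
  (forall t, 0 < t <= eps -> f t <= g t) ->
  step_average eps f <= step_average eps g.
Proof.
move=> bf bg fg; have fin0 : (@lebesgue_measure R `[0%R, eps]%classic < +oo)%E.
  by apply: le_lt_trans (ltry eps); rewrite (lebesgue_measure_steps eps_gt0).
have i0 (k : R -> R) : @bounded_measurable _ (measurableTypeR R) R k ->
    (@lebesgue_measure R).-integrable `]0%R, eps] (EFin \o k).
  move=> bk; apply: (integrableS _ _ _ (bounded_measurable_integrable _ fin0
    bk)) => //.
  exact: subset_itv_oc_cc.
rewrite /step_average /average ler_pM2l; last first.
  by rewrite (congr1 fine (lebesgue_measure_steps eps_gt0)) invr_gt0.
rewrite -!Rintegral_itv_obnd_cbnd; [|exact: i0|exact: i0].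
by apply: le_Rintegral => //; exact: i0.
Qed.

Lemma ball_average_le x u v : bounded_measurable u -> bounded_measurable v ->
  (forall y, eball x eps y -> u y <= v y) ->
  ball_average eps x u <= ball_average eps x v.
Proof.
move=> bu bv uv; apply: (average_le (measurable_eball x eps) (ball_measure eps
  x)) => //.
exact: ball_measure_gt0.
Qed.

Lemma ball_averageD x u v : bounded_measurable u -> bounded_measurable v ->
  ball_average eps x (fun y => u y + v y) =
  ball_average eps x u + ball_average eps x v.
Proof.
by move=> bu bv; apply: (averageD (measurable_eball x eps) (ball_measure eps
  x)).
Qed.

Lemma ball_averageN x u : bounded_measurable u ->
  ball_average eps x (fun y => - u y) = - ball_average eps x u.
Proof.
by move=> bu; apply: (averageN (measurable_eball x eps) (ball_measure eps x)).
Qed.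

Lemma ball_averageZ x u a : bounded_measurable u ->
  ball_average eps x (fun y => a * u y) = a * ball_average eps x u.
Proof.
by move=> bu; apply: (averageZ (measurable_eball x eps) (ball_measure eps x)).
Qed.

Lemma step_averageD (f g : R -> R) :
  @bounded_measurable _ (measurableTypeR R) R f ->
  @bounded_measurable _ (measurableTypeR R) R g ->
  step_average eps (fun t => f t + g t) =
    step_average eps f + step_average eps g.
Proof. by move=> bf bg; apply: (averageD _ (lebesgue_measure_steps eps_gt0)).
  Qed.

Lemma value_step_bounded u : measurable_fun setT u -> bounded_by M u ->
  bounded_by M (value_step u).
Proof.
move=> mu uM x; rewrite /value_step; case: ifPn => [_|_]; last exact: GM.
have bu : bounded_measurable u by split => //; exists M.
have bs := bounded_measurable_sup_inf x uM.
have bc (c : R) := @bounded_measurable_cst _ 'rV[R]_n R c.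
have bcR (c : R) := @bounded_measurable_cst _ (measurableTypeR R) R c.
have h1 : step_average eps (sup_inf u x) <= M *+ 2.
  rewrite -[leRHS]step_average_cst; apply: step_average_le => // t _.
  exact: le_trans (ler_norm _) (sup_inf_bounded x t uM).
have h2 : - (M *+ 2) <= step_average eps (sup_inf u x).
  rewrite -[leLHS]step_average_cst; apply: step_average_le => // t _ /=.
  by have := sup_inf_bounded x t uM; rewrite ler_norml => /andP[].
have h3 : ball_average eps x u <= M.
  rewrite -[leRHS](ball_average_cst x); apply: ball_average_le => // y _.
  exact: le_trans (ler_norm _) (uM y).
have h4 : - M <= ball_average eps x u.
  rewrite -[leLHS](ball_average_cst x); apply: ball_average_le => // y _ /=.
  by have := uM y; rewrite ler_norml => /andP[].
rewrite !mulr2n in h1 h2; rewrite ler_norml.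
have := ab1; have := a_gt0; have := b_gt0.
set a := alpha n p; set b := beta n p => b0 a0 ab.
set s := step_average _ _ in h1 h2 *; set q := ball_average _ _ _ in h3 h4 *.
have a2 : 0 <= a / 2 by rewrite divr_ge0// ltW.
have aM : a / 2 * (M + M) = a * M by field.
have := ler_wpM2l a2 h1; have := ler_wpM2l a2 h2.
have := ler_wpM2l (ltW b0) h3; have := ler_wpM2l (ltW b0) h4.
have e : a * M + b * M = M by rewrite -mulrDl ab mul1r.
by rewrite !mulrN aM; move=> *; apply/andP; split; lra.
Qed.

(** Tonelli's theorem for the jointly measurable [sup_inf], shifted by [2 N] to become
    nonnegative. *)
Lemma measurable_step_average N u : bounded_by N u ->
  measurable_fun setT (fun x => step_average eps (sup_inf u x)).
Proof.
move=> uN; pose f (z : 'rV[R]_n * measurableTypeR R) : \bar R :=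
  ((sup_inf u z.1 z.2 + N *+ 2) * \1_(`[0, eps]%classic : set R) z.2)%:E.
have s0 x t : 0 <= sup_inf u x t + N *+ 2.
  by have := sup_inf_bounded x t uN; rewrite ler_norml; lra.
have f0 z : (0 <= f z)%E by rewrite lee_fin mulr_ge0// indicE.
have mf : measurable_fun setT f.
  apply/measurable_EFinP; apply: measurable_funM.
    apply: measurable_funD => //; apply: (measurable_sup_inf uN).
      exact: measurable_fst.
    exact: measurable_snd.
  apply: (measurableT_comp _ measurable_snd).
  by apply: measurable_indic; exact: measurable_itv.
have := measurable_fun_fubini_tonelli_F (m2 := @lebesgue_measure R) f mf f0.
pose bc (r : R) := @bounded_measurable_cst _ (measurableTypeR R) R r.
have E x : fubini_F (@lebesgue_measure R) f x =
    (eps * (step_average eps (sup_inf u x) + N *+ 2))%:E.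
  have bs := bounded_measurable_sup_inf x uN.
  have bsum := bounded_measurableD bs (bc (N *+ 2)).
  rewrite -[X in _ + X]step_average_cst -step_averageD//.
  have := averageE _ (lebesgue_measure_steps eps_gt0) bsum.
  rewrite -/(step_average eps _) => /(_ (measurable_itv _)) h.
  rewrite EFinM -h (congr1 fine (lebesgue_measure_steps eps_gt0)) muleA -EFinM.
  rewrite divff ?gt_eqF// mul1e /fubini_F [RHS]integral_mkcond.
  apply: eq_integral => t _; rewrite patchE /f /= indicE.
  by case: ifPn => _; rewrite ?mulr1 ?mulr0.
move=> mF; rewrite (_ : (fun _ => _) = fun x =>
    eps^-1 * fine (fubini_F (@lebesgue_measure R) f x) - N *+ 2); last first.
  by apply/funext => x; rewrite E /= mulKf ?gt_eqF// addrK.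
apply: measurable_funB => //; apply: measurable_funM => //.
exact: (measurableT_comp (fine_measurable measurableT) mF).
Qed.

Lemma measurable_ball_average u : bounded_measurable u ->
  measurable_fun setT (fun x => ball_average eps x u).
Proof.
move=> bu; have [mu [N uN]] := bu.
have bc := @bounded_measurable_cst _ 'rV[R]_n R N.
have buN : bounded_measurable (fun y => u y + cst N y) by exact:
  bounded_measurableD.
have uN0 y : (0 <= (u y + cst N y)%:E)%E.
  by rewrite lee_fin /cst; have := uN y; rewrite ler_norml; lra.
have muN : measurable_fun setT (fun y => (u y + cst N y)%:E).
  by apply/measurable_EFinP; exact: buN.1.
pose l x := uniform_measure (lebesgue_rV R n) (measurable_eball x eps).
have ml U : measurable U -> measurable_fun setT (l ^~ U).
  by move=> mU; exact: measurable_uniform_on_eball.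
have := measurable_fun_integral_kernel ml uN0 muN.
have E x : (\int[l x]_y (u y + cst N y)%:E = (ball_average eps x u + N)%:E)%E.
  rewrite ge0_integral_uniform_measure//.
  rewrite (averageE (measurable_eball x eps) (ball_measure eps x) buN).
  by rewrite -[X in _ = (_ + X)%:E](ball_average_cst x) -ball_averageD.
under eq_fun do rewrite E.
move=> /measurable_EFinP mE.
rewrite (_ : (fun _ => _) = fun x => (ball_average eps x u + N) - N).
  exact: measurable_funB.
by apply/funext => x; rewrite addrK.
Qed.

Lemma measurable_value_step u : bounded_measurable u ->
  measurable_fun setT (value_step u).
Proof.
move=> bu; have [mu [N uN]] := bu.
apply: measurable_fun_ifT => //.
  apply: (measurable_fun_bool true); rewrite setTI.
  by rewrite (_ : _ @^-1` _ = Omega)//; apply/seteqP; split => h /= /asboolP.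
apply: measurable_funD; apply: measurable_funM => //.
  exact: measurable_step_average uN.
exact: measurable_ball_average.
Qed.

Variables (V : 'rV[R]_n -> R) (C c : R).
Hypothesis bV : bounded_measurable V.
Hypothesis VC : forall x, 0 <= V x <= C.
Hypotheses (c_gt0 : 0 < c) (cC : c <= C).
Hypothesis VP : forall x, Omega x -> V x + c <= beta n p * ball_average eps x V.

Let psi x := C *+ 2 - V x.
Let la := 1 - c / (C *+ 2).

Let C_gt0 : 0 < C := lt_le_trans c_gt0 cC.

Let la_itv : 0 <= la < 1.
Proof.
rewrite /la gtrBl divr_gt0 ?mulrn_wgt0// andbT subr_ge0.
by rewrite ler_pdivrMr ?mulrn_wgt0// mul1r (le_trans cC)// mulr2n lerDl ltW.
Qed.

(** The supremum and the infimum increase by at most [2 C a] each, as [psi <= 2 C]; the noise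
    contributes [a] times [beta * (2 C - mean V)]. Together this is at most [a * (2 C - V x - c)],
    that is [a * (psi x - c)], and [psi x - c <= la * psi x]. The one-sided form with [a = 0] is
    monotonicity. *)
Lemma value_step_contraction u v a : 0 <= a ->
  measurable_fun setT u -> measurable_fun setT v ->
  bounded_by M u -> bounded_by M v ->
  (forall y, u y <= v y + a * psi y) ->
  forall x, value_step u x <= value_step v x + la * a * psi x.
Proof.
move=> a0 mu mv uM vM uv x; have /andP[la0 la1] := la_itv.
have psi0 y : 0 <= psi y.
  by rewrite /psi subr_ge0 mulr2n; have := VC y; have := C_gt0; lra.
rewrite /value_step; case: ifPn => [/asboolP Ox|_]; last first.
  by rewrite lerDl !mulr_ge0.
have bu : bounded_measurable u by split => //; exists M.
have bv : bounded_measurable v by split => //; exists M.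
have h1 : step_average eps (sup_inf u x) <=
    step_average eps (sup_inf v x) + (a * (C *+ 2)) *+ 2.
  have bc := @bounded_measurable_cst _ (measurableTypeR R) R ((a * (C *+ 2)) *+
    2).
  rewrite -[X in _ + X]step_average_cst -step_averageD//.
  - apply: step_average_le => //.
    + exact: bounded_measurable_sup_inf uM.
    + by apply: bounded_measurableD => //; exact: bounded_measurable_sup_inf vM.
    + move=> t _; apply: sup_inf_le uM vM _ _.
        by rewrite mulr_ge0// mulrn_wge0// ltW.
      move=> y; apply: (le_trans (uv y)); rewrite lerD2l ler_wpM2l//.
      by rewrite /psi gerBl; have /andP[] := VC y.
  - exact: bounded_measurable_sup_inf vM.
have h2 : ball_average eps x u <=
    ball_average eps x v + (a * (C *+ 2) - a * ball_average eps x V).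
  have b1 : bounded_measurable (fun y => - (a * V y)).
    exact/bounded_measurableN/bounded_measurableZ.
  have b2 := @bounded_measurable_cst _ 'rV[R]_n R (a * (C *+ 2)).
  have b3 := bounded_measurableD b2 b1.
  rewrite -[X in _ + (X - _)](ball_average_cst x) -ball_averageZ//.
  rewrite -ball_averageN; last exact: bounded_measurableZ.
  rewrite -!ball_averageD//; apply: ball_average_le => //.
    exact: bounded_measurableD.
  by move=> y _; apply: (le_trans (uv y)); rewrite /psi mulrBr.
have k1 : alpha n p / 2 * step_average eps (sup_inf u x) <=
    alpha n p / 2 * step_average eps (sup_inf v x) + alpha n p * (a * (C *+ 2)).
  have -> : alpha n p * (a * (C *+ 2)) = alpha n p / 2 * ((a * (C *+ 2)) *+ 2).
    by rewrite -[in RHS](mulr_natr _ 2); field.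
  by rewrite -mulrDr; apply: ler_wpM2l => //; rewrite divr_ge0// ltW.
have k2 : beta n p * ball_average eps x u <= beta n p * ball_average eps x v +
    (beta n p * (a * (C *+ 2)) - a * (beta n p * ball_average eps x V)).
  rewrite (mulrCA a) -mulrBr -mulrDr; apply: ler_wpM2l => //; exact: ltW.
have k3 : a * (V x + c) <= a * (beta n p * ball_average eps x V).
  by apply: ler_wpM2l => //; exact: VP.
have k4 : a * (C *+ 2 - V x - c) <= la * a * psi x.
  have C0 : C != 0 by rewrite gt_eqF.
  have -> : la * a * psi x =
      a * (C *+ 2 - V x - c) + a * (c / (C *+ 2) * V x).
    by rewrite /la /psi -(mulr_natr C); field.
  have /andP[Vx0 _] := VC x.
  rewrite lerDl; do 2 apply: mulr_ge0 => //.
  by apply: divr_ge0; [exact: ltW|rewrite mulrn_wge0// ltW].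
have k5 : alpha n p * (a * (C *+ 2)) + beta n p * (a * (C *+ 2)) = a * (C *+ 2).
  by rewrite -mulrDl ab1 mul1r.
lra.
Qed.

(** The starting point [- M] lies below every function bounded by [M], in particular below its own
    image; monotonicity then makes the iterates increase. *)
Let U k := iter k value_step (cst (- M)).

Let bU k : measurable_fun setT (U k) /\ bounded_by M (U k).
Proof.
elim: k => [|k [mUk UkM]].
  by split => // x; rewrite /U /= normrN ger0_norm.
split; last exact: value_step_bounded.
by apply: measurable_value_step; split => //; exists M.
Qed.

Let value_step_mono u v : measurable_fun setT u -> measurable_fun setT v ->
  bounded_by M u -> bounded_by M v -> (forall y, u y <= v y) ->
  forall x, value_step u x <= value_step v x.
Proof.
move=> mu mv uM vM uv x.
have uv0 y : u y <= v y + 0 * psi y by rewrite mul0r addr0.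
have := value_step_contraction (lexx 0) mu mv uM vM uv0 x.
by rewrite mulr0 mul0r addr0.
Qed.

Let U_nd x : nondecreasing_seq (U ^~ x).
Proof.
apply/nondecreasing_seqP => k; elim: k x => [|k IHk] x.
  by have := (bU 1).2 x; rewrite ler_norml => /andP[].
by apply: value_step_mono => //; [exact: (bU k).1|exact: (bU k.+1).1|
  exact: (bU k).2|exact: (bU k.+1).2].
Qed.

Let U_cvg x : cvgn (U ^~ x).
Proof.
apply: nondecreasing_is_cvgn; first exact: U_nd.
by exists M => _ [k _ <-]; apply: le_trans (ler_norm _) ((bU k).2 x).
Qed.

Let u x := limn (U ^~ x).

Let leU_u k x : U k x <= u x.
Proof. exact: (nondecreasing_cvgn_le (@U_nd x) (@U_cvg x)). Qed.

Let u_le x a : (forall k, U k x <= a) -> u x <= a.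
Proof. by move=> ha; apply: limr_le; [exact: U_cvg|exact: nearW]. Qed.

Let uM : bounded_by M u.
Proof.
move=> x; rewrite ler_norml; apply/andP; split.
  exact: (leU_u 0 x).
by apply: u_le => k; apply: le_trans (ler_norm _) ((bU k).2 x).
Qed.

Let mu : measurable_fun setT u.
Proof.
apply: (measurable_fun_cvg (h := U)); first by move=> k; exact: (bU k).1.
by move=> x _; exact: U_cvg.
Qed.

(** The first two iterates differ by at most [2 M], hence by at most [a0 * psi] since [psi >= C];
    [a1] is the sum of the geometric series with first term [a0] and ratio [la]. *)
Let a0 := M *+ 2 / C.
Let a1 := a0 / (1 - la).

Let a0_ge0 : 0 <= a0.
Proof. by apply: divr_ge0; [rewrite mulrn_wge0|exact: ltW]. Qed.

Let la_lt1 : 0 < 1 - la.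
Proof. by have /andP[_] := la_itv; rewrite subr_gt0. Qed.

Let a1_ge0 : 0 <= a1.
Proof. by apply: divr_ge0 => //; exact: ltW. Qed.

Let C_le_psi x : C <= psi x.
Proof. by rewrite /psi mulr2n; have /andP[_] := VC x; lra. Qed.

Let psi_ge0 x : 0 <= psi x.
Proof. exact: le_trans (ltW C_gt0) (C_le_psi x). Qed.

Let U_step k x : U k.+1 x <= U k x + la ^+ k * a0 * psi x.
Proof.
have /andP[la0 _] := la_itv.
elim: k x => [|k IHk] x.
  rewrite expr0 mul1r; have := (bU 1).2 x; have := (bU 0).2 x.
  have : M *+ 2 <= a0 * psi x.
    apply: (@le_trans _ _ (a0 * C)); last exact: ler_wpM2l.
    by rewrite /a0 divfK// gt_eqF.
  by rewrite !ler_norml mulr2n; lra.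
have h : 0 <= la ^+ k * a0 by rewrite mulr_ge0// exprn_ge0.
have := value_step_contraction h (bU k.+1).1 (bU k).1 (bU k.+1).2 (bU k).2 IHk
  x.
by rewrite mulrA -exprS.
Qed.

Let U_tail k j x :
  U (k + j) x <= U k x + a1 * (la ^+ k - la ^+ (k + j)) * psi x.
Proof.
elim: j => [|j IHj]; first by rewrite addn0 subrr mulr0 mul0r addr0.
rewrite addnS; apply: (le_trans (U_step _ _)).
have -> : a0 = a1 * (1 - la) by rewrite /a1 divfK// gt_eqF.
apply: (le_trans (lerD IHj (lexx _))).
by rewrite exprS le_eqVlt; apply/orP; left; apply/eqP; ring.
Qed.

Let u_tail k x : u x <= U k x + la ^+ k * a1 * psi x.
Proof.
have /andP[la0 _] := la_itv.
apply: u_le => j; have [kj|jk] := leqP k j.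
  rewrite -(subnKC kj); apply: (le_trans (U_tail _ _ _)).
  rewrite lerD2l (mulrC a1) ler_wpM2r// ler_wpM2r// gerBl exprn_ge0//.
apply: (le_trans (U_nd x (ltnW jk))).
by rewrite lerDl; do 2 apply: mulr_ge0 => //; exact: exprn_ge0.
Qed.

(** That [u] lies below its image follows from monotonicity. For the converse, [u] exceeds [U k] by
    a geometrically small multiple of [psi], so its image exceeds [U k.+1], hence [u], by
    arbitrarily little. *)
Lemma exists_value_step_fixpoint : exists w, [/\ measurable_fun setT w,
  bounded_by M w & forall x, value_step w x = w x].
Proof.
have /andP[la0 la1] := la_itv.
exists u; split => // x; apply/eqP; rewrite eq_le; apply/andP; split;
  last first.
  apply: u_le => k; apply: (le_trans (U_nd x (leqnSn k))).
  apply: value_step_mono => //; [exact: (bU k).1|exact: (bU k).2].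
apply/ler_addgt0Pr => e e0.
have [k ke] : exists k, la ^+ k * (la * a1 * psi x) < e.
  have h : la ^+ k * (la * a1 * psi x) @[k --> \oo] --> 0 * (la * a1 * psi x).
    by apply: cvgMl; apply: cvg_expr; rewrite ger0_norm.
  rewrite mul0r in h.
  have /cvgrPdist_lt/(_ e e0)[k _ /(_ k (leqnn k))] := h.
  rewrite /= sub0r normrN => hk; exists k; apply: le_lt_trans hk;
    exact: ler_norm.
have h : 0 <= la ^+ k * a1 by rewrite mulr_ge0// exprn_ge0.
apply: (le_trans (value_step_contraction h mu (bU k).1 uM (bU k).2 (u_tail k)
  x)).
apply: lerD; first exact: (leU_u k.+1 x).
by apply: ltW; apply: le_lt_trans ke; rewrite le_eqVlt; apply/orP; left;
  apply/eqP; ring.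
Qed.

End dynamic_programming.

Lemma exists_dpp_solution (R : realType) (n : nat) (p eps : R)
    (Omega : set 'rV[R]_n) (G : 'rV[R]_n -> R) (M : R) :
  (0 < n)%N -> 2 < p -> 0 < eps -> measurable Omega -> bounded_set Omega ->
  measurable_fun setT G -> bounded_by M G ->
  exists u, [/\ measurable_fun setT u, bounded_by M u &
    forall x, value_step p eps Omega G u x = u x].
Proof.
move=> n0 p2 e0 mO bO mG GM.
have [V [C [c [bV VC c0 cC VP]]]] := lyapunov_function n0 p2 e0 bO.
exact: (exists_value_step_fixpoint n0 p2 e0 mO mG GM bV VC c0 cC VP).
Qed.

(** * The token under given strategies *)

(** Making the [P i] disjoint leaves a unique index, that of the first [P i] containing [y]. The
    function takes countably many values on measurable pieces, with the default [D 0] off their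
    union. *)
Lemma measurable_first_choice d d' (Y : measurableType d)
    (Z : measurableType d') (P : nat -> set Y) (D : nat -> Z) :
  (forall i, measurable (P i)) ->
  exists f : Y -> Z, measurable_fun setT f /\
    forall y, (exists i, P i y) -> exists2 i, P i y & f y = D i.
Proof.
move=> mP; pose Q := seqDU P.
have mQ i : measurable (Q i).
  apply: measurableD => //; apply: bigsetU_measurable => j _; exact: mP.
have tQ := @trivIset_seqDU _ P.
pose idx y := xget 0%N [set i | Q i y].
have idxE i y : Q i y -> idx y = i.
  move=> Qiy; have Qy : Q (idx y) y.
    by apply: (@xgetPex _ 0%N [set i | Q i y]); exists i.
  exact: (tQ _ _ Logic.I Logic.I (ex_intro _ y (conj Qy Qiy))).
exists (D \o idx); split; last first.
  move=> y [i Piy]; have : (\bigcup_i P i) y by exists i.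
  rewrite seqDU_bigcup_eq => -[j _ Qjy]; exists j; first by case: Qjy.
  by rewrite /= (idxE j).
move=> _ A mA; rewrite setTI.
rewrite (_ : _ @^-1` A = (\bigcup_(i in [set i | A (D i)]) Q i) `|`
    (if `[< A (D 0%N) >] then ~` \bigcup_i P i else set0)).
  apply: measurableU; first by apply: bigcup_measurable => i _.
  by case: ifP => // _; apply: measurableC; exact: bigcupT_measurable.
apply/seteqP; split => y /=.
  move=> Ay; have [[i Qiy]|nQ] := pselect (exists i, Q i y).
    by left; exists i => //=; rewrite -(idxE i y).
  right; have idx0 : idx y = 0%N.
    by rewrite /idx xgetPN// => i Qiy; apply: nQ; exists i.
  rewrite asboolT -?idx0//= => -[i _ Piy]; apply: nQ.
  have : (\bigcup_i P i) y by exists i.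
  by rewrite seqDU_bigcup_eq => -[j _ Qjy]; exists j.
move=> [[i /= Ai Qiy]|]; first by rewrite (idxE i).
case: ifPn => //= /asboolP A0 nP.
rewrite /idx xgetPN// => i [Piy _]; apply: nP; by exists i.
Qed.

(** The next position is the first of the countably many [D i] that is both admissible and good
    enough. This is a measurable condition on history and step because the supremum is a Borel
    function of both. *)
Lemma exists_near_optimal_strategy (R : realType) (n : nat) (eps M : R)
    (u : 'rV[R]_n -> R) (eta : nat -> R) :
  bounded_by M u -> (forall k, 0 < eta k) ->
  exists S : strategy n eps, forall k (h : history R n k) t, 0 < t ->
    sup (u @` eball (position h) t) - eta k < u (S k (h, t)).
Proof.
move=> uM eta0; have [D DP] := exists_dense_points uM.
pose P k i := [set ht : history R n k * R |
  eball (position ht.1) ht.2 (D i) /\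
  sup (u @` eball (position ht.1) ht.2) - eta k < u (D i)].
have mpos k : measurable_fun setT (fun ht : history R n k * R => position ht.1).
  exact: (measurableT_comp (@measurable_position R n k) measurable_fst).
have mP k i : measurable (P k i).
  apply: measurableI.
    have ml : measurable_fun setT (fun ht : history R n k * R =>
        (enorm (D i - position ht.1) < ht.2)%R).
      apply: measurable_fun_ltr; last exact: measurable_snd.
      by apply: (measurable_fun_enormB (f := cst (D i))) => //; exact: mpos.
    by rewrite -[X in measurable X]setTI; exact: (ml measurableT [set true]).
  have ml : measurable_fun setT (fun ht : history R n k * R =>
      (sup (u @` eball (position ht.1) ht.2) - eta k < u (D i))%R).
    apply: measurable_fun_ltr => //; apply: measurable_funB => //.
    apply: (measurable_sup_eball uM); [exact: mpos|exact: measurable_snd].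
  by rewrite -[X in measurable X]setTI; exact: (ml measurableT [set true]).
pose f k := sval (cid (measurable_first_choice D (mP k))).
have mf k : measurable_fun setT (f k) :=
  (svalP (cid (measurable_first_choice D (mP k)))).1.
have fP k : forall y, (exists i, P k i y) -> exists2 i, P k i y & f k y = D i.
  exact: (svalP (cid (measurable_first_choice D (mP k)))).2.
have optimal k (h : history R n k) t : 0 < t -> exists2 i, P k i (h,
  t) & f k (h, t) = D i.
  move=> t0; apply: fP.
  have ne : eball (position h) t !=set0 by apply/eball_nonempty.
  (* One half of the error goes to a point nearly attaining the supremum, the other to its
     replacement by some [D i]. *)
  have e2 : 0 < eta k / 2 by rewrite divr_gt0.
  have [_ [z Bz <-] zs] := sup_adherent e2 (bounded_by_has_sup uM ne).
  have [i [Bi ui]] := DP _ z _ (@open_eball R n (position h) t) Bz e2.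
  by exists i; split => //=; lra.
unshelve eexists.
  apply: (@Strategy _ _ _ f) => [k|k h t /andP[t0 _]]; first exact: mf.
  by have [i [Bi _] ->] := optimal k h t t0.
by move=> k h t t0 /=; have [i [_ Bi] ->] := optimal k h t t0.
Qed.

Section game_geometry.
Context (R : realType) (n : nat) (eps : R) (Omega : set 'rV[R]_n).
Hypothesis oOmega : open Omega.

Lemma measurable_Gamma_eps : measurable (Gamma_eps eps Omega).
Proof.
rewrite (_ : Gamma_eps eps Omega =
  ~` Omega `&` [set x | edist_set x (boundary Omega) <= eps])//.
apply: measurableI; last exact: measurable_edist_le.
by apply: measurableC; exact: open_measurable_rV.
Qed.

Lemma measurable_Omega_eps : measurable (Omega_eps eps Omega).
Proof.
by apply: measurableU; [exact: open_measurable_rV|exact: measurable_Gamma_eps].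
Qed.

(** A move from [Omega] cannot jump over the strip: if it leaves [Omega], its segment crosses the
    boundary at distance at most [eps] from the new position. *)
Lemma eball_sub_Omega_eps x t : Omega x -> t <= eps ->
  eball x t `<=` Omega_eps eps Omega.
Proof.
move=> Ox te y yx; have [Oy|nOy] := pselect (Omega y); [by left|right].
split => //; have [b bb yb] := segment_meets_boundary oOmega Ox nOy.
apply: (@le_trans _ _ (enorm (y - b))); last first.
  exact: le_trans yb (le_trans (ltW yx) te).
apply: ge_inf; last by exists b.
by exists 0 => _ [z _ <-]; exact: enorm_ge0.
Qed.

End game_geometry.

(** * Means along the game, almost sure stopping and the limit of the means *)

Section game_analysis.
Context (R : realType) (n : nat) (p eps : R) (Omega : set 'rV[R]_n).
Hypotheses (n_gt0 : (0 < n)%N) (p_gt2 : 2 < p) (eps_gt0 : 0 < eps).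
Hypotheses (oOmega : open Omega) (bOmega : bounded_set Omega).
Variables (x0 : 'rV[R]_n) (S1 S2 : strategy n eps).

Let mOmega : measurable Omega := open_measurable_rV oOmega.
Let P := game_law p Omega x0 S1 S2.
Let PP : is_game_law p Omega x0 S1 S2 P :=
  game_lawP n_gt0 p_gt2 eps_gt0 mOmega S1 S2 x0.

Lemma state0 w : state x0 w 0 = x0.
Proof. by rewrite /state (tuple0 (first_rounds 0 w)). Qed.

Lemma stateS w k : state x0 w k.+1 = (w k).2.2.
Proof. by rewrite /state positionS /= tnth_mktuple. Qed.

Lemma measurable_round k :
  measurable_fun setT (fun w : trajectory R n => w k).
Proof. exact: (@measurable_coordinate _ (round R n) k). Qed.

Lemma measurable_first_rounds k :
  measurable_fun setT (@first_rounds R n k : trajectory R n -> _).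
Proof. exact: (@measurable_initial _ (round R n) k). Qed.

Lemma measurable_state k :
  measurable_fun setT (fun w : trajectory R n => state x0 w k).
Proof.
exact: (measurableT_comp (@measurable_position R n k)
  (measurableT_comp (measurable_pair1 x0) (@measurable_first_rounds k))).
Qed.

Definition state_mean k (g : 'rV[R]_n -> R) : R := \int[P]_w g (state x0 w k).

Let bounded_state k (g : 'rV[R]_n -> R) : bounded_measurable g ->
  bounded_measurable (fun w : trajectory R n => g (state x0 w k)).
Proof. by move=> bg; exact: (bounded_measurable_comp (@measurable_state k) bg).
  Qed.

Let Pfin : (P setT < +oo)%E.
Proof. by rewrite probability_setT ltry. Qed.

Lemma state_meanE k g : bounded_measurable g ->
  (\int[P]_w (g (state x0 w k))%:E = (state_mean k g)%:E)%E.
Proof.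
move=> bg; rewrite /state_mean /Rintegral fineK//.
apply: integrable_fin_num => //.
by apply: bounded_measurable_integrable => //; exact: bounded_state.
Qed.

Lemma state_meanD k g g' : bounded_measurable g -> bounded_measurable g' ->
  state_mean k (fun x => g x + g' x) = state_mean k g + state_mean k g'.
Proof.
move=> bg bg'; rewrite /state_mean RintegralD//;
  by apply: bounded_measurable_integrable => //; exact: bounded_state.
Qed.

Lemma state_meanZ k g a : bounded_measurable g ->
  state_mean k (fun x => a * g x) = a * state_mean k g.
Proof.
move=> bg; rewrite /state_mean RintegralZl//.
by apply: bounded_measurable_integrable => //; exact: bounded_state.
Qed.

Lemma state_mean_cst k c : state_mean k (cst c) = c.
Proof. by rewrite /state_mean Rintegral_cst// probability_setT mulr1. Qed.

Lemma state_meanN k g : bounded_measurable g ->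
  state_mean k (fun x => - g x) = - state_mean k g.
Proof.
move=> bg; apply/eqP; rewrite -addr_eq0; apply/eqP.
rewrite -state_meanD//; last exact: bounded_measurableN.
rewrite -[RHS](state_mean_cst k); congr (state_mean k _).
by apply/funext => x; rewrite addNr.
Qed.

Lemma state_mean0 g : state_mean 0 g = g x0.
Proof.
rewrite -[RHS](state_mean_cst 0) /state_mean.
by apply: eq_Rintegral => w _; rewrite state0.
Qed.

Lemma state_mean_le k g g' : bounded_measurable g -> bounded_measurable g' ->
  (forall x, g x <= g' x) -> state_mean k g <= state_mean k g'.
Proof.
move=> bg bg' gg'; apply: le_Rintegral => //;
  by apply: bounded_measurable_integrable => //; exact: bounded_state.
Qed.

Let mpos_round : measurable_fun setT (fun r : round R n => r.2.2).
Proof. exact: (measurableT_comp measurable_snd measurable_snd). Qed.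

(** A submartingale inequality in mean. By the game law with [B] the whole space, the distribution
    of round [k] is the mixture of the conditional laws over trajectories, so the conditional
    estimate integrates to one between means. *)
Lemma state_mean_step k g g' : bounded_measurable g -> bounded_measurable g' ->
  (forall h : history R n k,
     g' (position h) <= round_mean p Omega S1 S2 h (fun r => g r.2.2)) ->
  state_mean k g' <= state_mean k.+1 g.
Proof.
move=> bg bg' gg'; have [[mg [N1 gN1]] [mg' [N2 gN2]]] := (bg, bg').
(* A single shift that makes both [g] and [g'] nonnegative. *)
pose N := N1 + N2.
have N1_ge0 : 0 <= N1 := le_trans (normr_ge0 _) (gN1 0).
have N2_ge0 : 0 <= N2 := le_trans (normr_ge0 _) (gN2 0).
have bN := @bounded_measurable_cst _ 'rV[R]_n R N.
have bgN : bounded_measurable (fun x => g x + cst N x) by exact: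
  bounded_measurableD.
have bgN' : bounded_measurable (fun x => g' x + cst N x) by exact:
  bounded_measurableD.
suff : state_mean k (fun x => g' x + cst N x) <=
       state_mean k.+1 (fun x => g x + cst N x).
  by rewrite !(@state_meanD _ _ (cst N))// !state_mean_cst lerD2r.
rewrite -lee_fin -!state_meanE//.
pose f (r : round R n) := g r.2.2 + N.
have bf : bounded_measurable f by exact: (bounded_measurable_comp mpos_round
  bgN).
have f0 r : 0 <= f r by have := gN1 r.2.2; rewrite /f /N ler_norml; lra.
have f0E r : (0 <= (f r)%:E)%E by rewrite lee_fin.
have mf : measurable_fun setT (EFin \o f) by apply/measurable_EFinP;
  exact: bf.1.
pose kappa (w : trajectory R n) :=
  round_measure Omega n_gt0 p_gt2 S1 S2 (x0, first_rounds k w).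
have mkappa U : measurable U -> measurable_fun setT (kappa ^~ U).
  move=> mU; rewrite (_ : (fun _ => _) = (fun h : history R n k =>
      round_law p Omega S1 S2 h U) \o (fun w => (x0, first_rounds k w))).
    apply: measurableT_comp; first exact: measurable_round_law.
    exact: (measurableT_comp (measurable_pair1 x0) (@measurable_first_rounds
      k)).
  by apply/funext => w; rewrite /kappa round_measureE.
pose m := image_measure P (@measurable_round k).
have mE A : measurable A -> m A = (\int[P]_w kappa w A)%E.
  move=> mA; have := @PP k setT A measurableT mA.
  rewrite (_ : [set w | setT (first_rounds k w) /\ A (w k)] =
    (fun w => w k) @^-1` A); last first.
    by apply/seteqP; split => w //= [].
  move=> e; rewrite /m /= /image_measure /pushforward; rewrite [LHS]e.
  rewrite (_ : [set w | setT (first_rounds k w)] = setT)//.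
  by apply: eq_integral => w _; rewrite /kappa round_measureE.
have -> : (\int[P]_w (g (state x0 w k.+1) + cst N (state x0 w k.+1))%:E =
    \int[P]_w (round_mean p Omega S1 S2 (x0, first_rounds k w) f)%:E)%E.
  transitivity (\int[m]_r (f r)%:E)%E.
    rewrite [RHS]ge0_integral_pushforward//; last exact: measurable_round.
    by apply: eq_integral => w _; rewrite stateS.
  rewrite (integral_mixture mkappa mE f0E mf).
  by apply: eq_integral => w _; rewrite /kappa ge0_integral_round_measure.
have mk : measurable_fun setT (fun w : trajectory R n =>
    (round_mean p Omega S1 S2 (x0, first_rounds k w) f)%:E).
  rewrite (_ : (fun _ => _) = (fun w => \int[kappa w]_r (f r)%:E)%E).
    exact: (measurable_fun_integral_kernel mkappa f0E mf).
  by apply/funext => w; rewrite /kappa ge0_integral_round_measure.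
apply: ge0_le_integral => //.
- by move=> w _; rewrite lee_fin /N; have := gN2 (state x0 w k);
    rewrite ler_norml /=; lra.
- by apply/measurable_EFinP; exact: (bounded_state k bgN').1.
- move=> w _; rewrite lee_fin /f round_meanD_cst//.
    by rewrite lerD2r; exact: gg'.
  exact: (bounded_measurable_comp mpos_round bg).
Qed.

Lemma state_mean_indic k (A : set 'rV[R]_n) : measurable A ->
  P [set w : trajectory R n | A (state x0 w k)] = (state_mean k \1_A)%:E.
Proof.
move=> mA; rewrite -state_meanE; last exact: bounded_measurable_indic.
have mS : measurable [set w : trajectory R n | A (state x0 w k)].
  by rewrite -[X in measurable X]setTI;
    exact: (@measurable_state k measurableT A mA).
transitivity (\int[P]_w (\1_[set w | A (state x0 w k)] w)%:E)%E.
  by rewrite integral_indic// setIT.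
by apply: eq_integral => w _; congr EFin.
Qed.

Lemma round_mean_ge0 k (h : history R n k) (g : 'rV[R]_n -> R) :
  bounded_measurable g -> Omega (position h) ->
  (forall y, eball (position h) eps y -> 0 <= g y) ->
  0 <= round_mean p Omega S1 S2 h (fun r => g r.2.2).
Proof.
move=> bg Oh g0; rewrite /round_mean asboolT//.
have a0 : 0 <= alpha n p / 2 by rewrite divr_ge0// ltW// alpha_gt0.
have s0 (S : strategy n eps) : 0 <= step_average eps (fun t => g (S k (h, t))).
  rewrite -[leLHS](step_average_cst eps_gt0); apply: step_average_le => //.
  - exact: bounded_measurable_cst.
  - exact: bounded_measurable_play.
  - move=> t /[dup] /andP[_ te] t0e; apply: g0.
    exact: lt_le_trans (next_position_eball S h t0e) te.
have b0 := ltW (beta_gt0 n_gt0 p_gt2).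
suff q0 : 0 <= ball_average eps (position h) g.
  exact: (addr_ge0 (addr_ge0 (mulr_ge0 b0 q0) (mulr_ge0 a0 (s0 S1)))
    (mulr_ge0 a0 (s0 S2))).
rewrite -[leLHS](ball_average_cst n_gt0 eps_gt0 (position h)).
by apply: ball_average_le => //; exact: bounded_measurable_cst.
Qed.

(** Minus the indicator of the complement of [Omega_eps] does not decrease in mean: from [Omega]
    every admissible move stays in [Omega_eps], and off [Omega] the token rests. The mean is 0 at
    the start. *)
Lemma negligible_state_out k : Omega_eps eps Omega x0 ->
  P.-negligible
    [set w : trajectory R n | ~ Omega_eps eps Omega (state x0 w k)].
Proof.
move=> x0O; pose N := ~` Omega_eps eps Omega.
have mN : measurable N by apply: measurableC; exact: measurable_Omega_eps.
have bN : bounded_measurable (\1_N : 'rV[R]_n ->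
  R) by exact: bounded_measurable_indic.
have bN1 := bounded_measurableN bN.
suff N0 : state_mean k \1_N = 0.
  apply/negligibleP; last by rewrite [LHS](state_mean_indic k mN) N0.
  by rewrite -[X in measurable X]setTI;
    exact: (@measurable_state k measurableT N mN).
have step j : state_mean j (fun x => - \1_N x) <=
  state_mean j.+1 (fun x => - \1_N x).
  apply: (state_mean_step bN1 bN1) => h.
  have [Oh|Oh] := pselect (Omega (position h)); last first.
    by rewrite /round_mean asboolF.
  apply: (@le_trans _ _ 0); first by rewrite oppr_le0 indicE.
  apply: (round_mean_ge0 bN1) => // y By.
  rewrite indicE memNset ?oppr0//.
  by apply; exact: (eball_sub_Omega_eps oOmega Oh (lexx _) By).
have decr j : state_mean j.+1 \1_N <= state_mean j \1_N.
  by move: (step j); rewrite (state_meanN j bN) (state_meanN j.+1 bN) lerN2.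
apply/eqP; rewrite eq_le; apply/andP; split; last first.
  rewrite -[leLHS](state_mean_cst k); apply: state_mean_le => //.
  exact: bounded_measurable_cst.
elim: k => [|k IHk]; last exact: le_trans (decr k) IHk.
by rewrite state_mean0 indicE memNset//; exact.
Qed.

Lemma measurable_rational_box c : measurable (@rational_box R n c).
Proof.
rewrite (_ : rational_box c = \bigcap_(i in [set: 'I_n])
    ((fun v : 'rV[R]_n => v ord0 i) @^-1`
      (ball (ratr (tnth c.1 i) : R) (ratr c.2)))).
  apply: fin_bigcap_measurable => // i _.
  rewrite -[X in measurable X]setTI; apply: measurable_coord => //.
  exact: measurable_ball.
apply/seteqP; split => [v h i _|v h i]; [exact: h|exact: (h i Logic.I)].
Qed.

(* [is_game_law] only bears on events of the form [B x A]: the event that the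
   token moves is covered by countably many of these, indexed by the rational
   boxes that separate the two positions. *)
Lemma negligible_state_moves k :
  P.-negligible [set w : trajectory R n | ~ Omega (state x0 w k) /\
     state x0 w k.+1 <> state x0 w k].
Proof.
pose B c := [set t : k.-tuple (round R n) |
  (rational_box c `\` Omega) (position (x0, t))].
pose A c := [set r : round R n | ~ rational_box c r.2.2].
have mB c : measurable (B c).
  rewrite -[X in measurable X]setTI.
  apply: (measurableT_comp (@measurable_position R n k) (measurable_pair1 x0))
    => //.
  by apply: measurableD => //; exact: measurable_rational_box.
have mA c : measurable (A c).
  rewrite -[X in measurable X]setTI.
  exact: (mpos_round measurableT (measurableC (measurable_rational_box c))).
pose W c := [set w : trajectory R n | B c (first_rounds k w) /\ A c (w k)].
have W0 c : P.-negligible (W c).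
  have mW : measurable (W c).
    apply: measurableI; rewrite -[X in measurable X]setTI.
      exact: (@measurable_first_rounds k).
    exact: (@measurable_round k).
  apply/negligibleP => //; rewrite [LHS](PP (mB c) (mA c)) integral0_eq//.
  move=> w [bw nOw]; rewrite /round_law asboolF//.
  by rewrite diracE memNset//; exact.
pose W' i := if unpickle i is Some c then W c else set0.
apply: (@negligibleS _ _ _ _ (\bigcup_i W' i)); last first.
  apply: negligible_bigcup => i; rewrite /W'; case: unpickle => // ;
    exact: negligible_set0.
move=> w [nO]; rewrite stateS => ne.
pose U := ~` [set (w k).2.2].
have oU : open U.
  apply: closed_openC; apply: accessible_closed_set1.
  exact/hausdorff_accessible/norm_hausdorff.
have Us : U (state x0 w k) by move=> e; apply: ne; rewrite /= in e; rewrite e.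
have [c cs cU] := rational_box_basis oU Us.
exists (pickle c) => //; rewrite /W' pickleK; split; first by split.
by move=> /cU; apply.
Qed.

Lemma negligible_never_exits :
  P.-negligible [set w : trajectory R n | forall k, Omega (state x0 w k)].
Proof.
have [V [C [c [bV VC c0 cC VP]]]] :=
  lyapunov_function n_gt0 p_gt2 eps_gt0 bOmega.
have bI : bounded_measurable (\1_Omega : 'rV[R]_n -> R).
  exact: bounded_measurable_indic.
have bcI := bounded_measurableZ c bI.
have step k : state_mean k V + c * state_mean k \1_Omega <= state_mean k.+1 V.
  rewrite -state_meanZ// -state_meanD//; apply: state_mean_step => //.
    exact: bounded_measurableD.
  move=> h; rewrite /round_mean indicE; case: ifPn => [/asboolP Oh|/asboolP Oh].
    rewrite mem_set// mulr1; apply: (le_trans (VP _ Oh)).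
    have a0 : 0 <= alpha n p / 2 by rewrite divr_ge0// ltW// alpha_gt0.
    have s0 (S : strategy n eps) : 0 <= step_average eps (fun t => V (S k (h,
      t))).
      rewrite -[leLHS](step_average_cst eps_gt0); apply: step_average_le => //.
      - exact: bounded_measurable_cst.
      - exact: bounded_measurable_play.
      - by move=> t _ /=; have /andP[] := VC (S k (h, t)).
    rewrite -addrA lerDl; apply: addr_ge0; apply: mulr_ge0 => //; exact: s0.
  by rewrite memNset// mulr0 addr0.
have sum k : c * \sum_(j < k) state_mean j \1_Omega <= state_mean k V.
  elim: k => [|k IHk]; last first.
    by rewrite big_ord_recr/= mulrDr (le_trans _ (step k))// lerD2r.
  by rewrite big_ord0 mulr0 state_mean0; have /andP[] := VC x0.
pose E := [set w : trajectory R n | forall k, Omega (state x0 w k)].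
have mE k : measurable [set w : trajectory R n | Omega (state x0 w k)].
  by rewrite -[X in measurable X]setTI;
    exact: (@measurable_state k measurableT Omega mOmega).
have EE : E = \bigcap_k [set w | Omega (state x0 w k)].
  by apply/seteqP; split => [w h k _|w h k]; [exact: h|exact: (h k Logic.I)].
have mEE : measurable E by rewrite EE; exact: bigcapT_measurable.
suff : P E = 0%E by move=> ?; apply/negligibleP.
have PE : P E = (fine (P E))%:E by rewrite fineK// fin_num_measure.
have PEk k : fine (P E) <= state_mean k \1_Omega.
  rewrite -lee_fin -PE -state_mean_indic//; apply: le_measure; rewrite ?inE//.
  by move=> w; exact.
(* Never exiting is contained in each event of being in [Omega] after [j] rounds, so each of the [k]
   summands is at least [P E], while their total is at most [C / c] for all [k]. *)
have bound k : c * (fine (P E) *+ k) <= C.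
  apply: le_trans (_ : state_mean k V <= _); last first.
    rewrite -[leRHS](state_mean_cst k); apply: state_mean_le => //.
      exact: bounded_measurable_cst.
    by move=> x; have /andP[] := VC x.
  apply: le_trans (sum k); rewrite ler_pM2l// -[X in _ *+ X]card_ord
    -sumr_const.
  by apply: ler_sum => j _; exact: PEk.
have PE0 : 0 <= fine (P E) by exact: fine_ge0.
rewrite PE; congr EFin; apply/eqP; rewrite eq_le PE0 andbT leNgt;
  apply/negP => PE1.
have := archi_boundP (divr_ge0 (le_trans (ltW c0) cC) (ltW (mulr_gt0 c0 PE1))).
rewrite ltr_pdivrMr ?mulr_gt0// ltNge => /negP; apply.
by have := bound (Num.bound (C / (c * fine (P E)))); rewrite -mulr_natl; lra.
Qed.

Variable F : 'rV[R]_n -> R.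
Hypothesis mF : measurable_fun setT (F \_ (Gamma_eps eps Omega)).

Let stops k := [set w : trajectory R n | Gamma_eps eps Omega (state x0 w k) /\
  forall j, (j < k)%N -> ~ Gamma_eps eps Omega (state x0 w j)].

Let stops_inj w k k' : stops k w -> stops k' w -> k = k'.
Proof.
move=> [Gk nk] [Gk' nk']; case: (ltngtP k k') => // kk'.
  by case: (nk' _ kk' Gk).
by case: (nk _ kk' Gk').
Qed.

Let tauE w k : stops k w -> tau eps Omega x0 w = k.
Proof.
move=> wk; apply: xget_unique; first exact: wk.
by move=> k' wk'; exact: stops_inj wk' wk.
Qed.

Let measurable_stops k : measurable (stops k).
Proof.
have mG j : measurable [set w :
  trajectory R n | Gamma_eps eps Omega (state x0 w j)].
  rewrite -[X in measurable X]setTI.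
  exact: (@measurable_state j measurableT _ (measurable_Gamma_eps eps oOmega)).
rewrite (_ : stops k = [set w | Gamma_eps eps Omega (state x0 w k)] `&`
    \bigcap_(j in [set j | (j < k)%N])
      ~` [set w | Gamma_eps eps Omega (state x0 w j)])//.
apply: measurableI => //; apply: bigcap_measurableType => j _.
exact: measurableC.
Qed.

(** Trajectories are split by the value of the stopping time. On those that never stop [tau] is the
    dummy 0, so the payoff is read at the initial position. *)
Lemma measurable_payoff :
  measurable_fun setT (payoff eps Omega F x0 : trajectory R n -> R).
Proof.
move=> _ A mA; rewrite setTI.
pose S k := [set w : trajectory R n | A ((F \_ (Gamma_eps eps Omega)) (state x0
  w k))].
have mS k : measurable (S k).
  rewrite -[X in measurable X]setTI.
  exact: (measurableT_comp mF (@measurable_state k) measurableT mA).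
rewrite (_ : _ @^-1` A = (\bigcup_k (stops k `&` S k)) `|`
    (~` (\bigcup_k stops k) `&` S 0%N)).
  apply: measurableU; first by apply: bigcupT_measurable => k;
    exact: measurableI.
  by apply: measurableI => //; apply: measurableC; exact: bigcupT_measurable.
apply/seteqP; split => w /=.
  rewrite /payoff => Aw; have [[k wk]|nw] := pselect (exists k, stops k w).
    by left; exists k => //; split => //; rewrite /S /= -(tauE wk).
  right; split; first by move=> [k _ wk]; apply: nw; exists k.
  rewrite /S /=; move: Aw; rewrite /tau xgetPN// => k wk.
  by apply: nw; exists k.
move=> [[k _ [wk Sk]]|[nw S0]]; rewrite /payoff; first by rewrite (tauE wk).
by rewrite /tau xgetPN// => k wk; apply: nw; exists k.
Qed.

Variables (u : 'rV[R]_n -> R) (M : R).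
Hypotheses (mu : measurable_fun setT u) (uM : bounded_by M u).
Hypothesis uF : forall x, ~ Omega x -> u x = (F \_ (Gamma_eps eps Omega)) x.
Hypothesis x0O : Omega_eps eps Omega x0.

Let bu : bounded_measurable u.
Proof. by split => //; exists M. Qed.

(** Outside a null set the trajectory leaves [Omega], its first position outside lies in
    [Gamma_eps], and it rests there. The sequence is then eventually constant, equal to the payoff
    because [u] has the boundary values off [Omega]. *)
Lemma ae_payoff_limit : {ae P, forall w, setT w ->
  (u (state x0 w k))%:E @[k --> \oo] --> (payoff eps Omega F x0 w)%:E}.
Proof.
pose N := (\bigcup_k [set w : trajectory R n | ~ Omega_eps eps Omega (state x0
  w k)])
  `|` (\bigcup_k [set w : trajectory R n | ~ Omega (state x0 w k) /\
     state x0 w k.+1 <> state x0 w k])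
  `|` [set w : trajectory R n | forall k, Omega (state x0 w k)].
have : P.-negligible N.
  apply: negligibleU; last exact: negligible_never_exits.
  apply: negligibleU; apply: negligible_bigcup => k.
    exact: negligible_state_out.
  exact: negligible_state_moves.
apply: negligibleS => w /= nw; apply: contrapT => wN; apply: nw => _.
have inO k : Omega_eps eps Omega (state x0 w k).
  by apply: contrapT => h; apply: wN; left; left; exists k.
have abs k : ~ Omega (state x0 w k) -> state x0 w k.+1 = state x0 w k.
  by move=> h; apply: contrapT => h'; apply: wN; left; right; exists k.
have [k0 k0O] : exists k, ~ Omega (state x0 w k).
  by apply/existsNP => h; apply: wN; right.
have ex : exists k, `[< ~ Omega (state x0 w k) >] by exists k0; apply/asboolP.
have [K /asboolP KO Kmin] := ex_minnP ex.
have Kstop : stops K w.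
  split; first by have [|] := inO K.
  move=> j jK [nOj _]; have := Kmin j (asboolT nOj).
  by rewrite leqNgt jK.
have abK j : state x0 w (K + j) = state x0 w K.
  elim: j => [|j IHj]; first by rewrite addn0.
  by rewrite addnS abs IHj.
apply: cvg_near_cst; exists K => // k /= Kk.
by rewrite -(subnKC Kk) abK uF// /payoff (tauE Kstop).
Qed.

Lemma state_mean_cvg : (state_mean k u)%:E @[k --> \oo] -->
  expected_payoff p Omega F x0 S1 S2.
Proof.
have mk k : measurable_fun setT (fun w :
  trajectory R n => (u (state x0 w k))%:E).
  by apply/measurable_EFinP; exact: (bounded_state k bu).1.
have mp : measurable_fun setT
    (fun w : trajectory R n => (payoff eps Omega F x0 w)%:E).
  by apply/measurable_EFinP; exact: measurable_payoff.
have iM : P.-integrable setT (cst M%:E).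
  apply: bounded_measurable_integrable => //.
  exact: (bounded_measurable_cst _ M).
have uMae : {ae P, forall w k, setT w -> (`|(u (state x0 w k))%:E| <=
  cst M%:E w)%E}.
  by apply: aeW => w k _; rewrite /= lee_fin; exact: uM.
have [_ _ cvg] := dominated_convergence measurableT mk mp ae_payoff_limit iM
  uMae.
rewrite /expected_payoff unlock; apply: cvg_trans cvg.
apply: near_eq_cvg; apply: nearW => k.
by rewrite /= -state_meanE.
Qed.

Let state_mean_ge (v : 'rV[R]_n -> R) (e : nat -> R) (d : R) k :
  bounded_measurable v -> (forall k, \sum_(j < k) e j <= d) ->
  (forall k (h : history R n k),
     v (position h) - e k <= round_mean p Omega S1 S2 h (fun r => v r.2.2)) ->
  v x0 - d <= state_mean k v.
Proof.
move=> bv ed ve.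
have step j : state_mean j v - e j <= state_mean j.+1 v.
  have be : bounded_measurable (cst (- e j) : 'rV[R]_n -> R).
    exact: bounded_measurable_cst.
  have := @state_mean_step j v (fun x => v x + cst (- e j) x) bv
    (bounded_measurableD bv be) (ve j).
  by rewrite (@state_meanD j v (cst (- e j)))// state_mean_cst.
apply: (@le_trans _ _ (v x0 - \sum_(j < k) e j)); first by rewrite lerD2l lerN2.
elim: k => [|k IHk]; first by rewrite big_ord0 subr0 state_mean0.
by rewrite big_ord_recr /= opprD addrA (le_trans _ (step k))// lerD2r.
Qed.

Lemma expected_payoff_ge (e : nat -> R) (d : R) :
  (forall k, \sum_(j < k) e j <= d) ->
  (forall k (h : history R n k),
     u (position h) - e k <= round_mean p Omega S1 S2 h (fun r => u r.2.2)) ->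
  ((u x0 - d)%:E <= expected_payoff p Omega F x0 S1 S2)%E.
Proof.
move=> ed ue; rewrite -(cvg_lim _ state_mean_cvg)//; apply: lime_ge.
  by apply/cvg_ex; eexists; exact: state_mean_cvg.
by apply: nearW => k; rewrite lee_fin; exact: state_mean_ge ue.
Qed.

Lemma expected_payoff_le (e : nat -> R) (d : R) :
  (forall k, \sum_(j < k) e j <= d) ->
  (forall k (h : history R n k), - u (position h) - e k <=
     round_mean p Omega S1 S2 h (fun r => - u r.2.2)) ->
  (expected_payoff p Omega F x0 S1 S2 <= (u x0 + d)%:E)%E.
Proof.
move=> ed ue; rewrite -(cvg_lim _ state_mean_cvg)//; apply: lime_le.
  by apply/cvg_ex; eexists; exact: state_mean_cvg.
apply: nearW => k; rewrite lee_fin.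
have := @state_mean_ge (fun x => - u x) e d k (bounded_measurableN bu) ed ue.
by rewrite state_meanN// -opprD lerN2.
Qed.

End game_analysis.

(** * The value of the game *)

Section value.
Context (R : realType) (n : nat) (p eps : R) (Omega : set 'rV[R]_n).
Hypotheses (n_gt0 : (0 < n)%N) (p_gt2 : 2 < p) (eps_gt0 : 0 < eps).
Hypotheses (oOmega : open Omega).

(** Changing signs exchanges suprema and infima, hence the roles of the players: estimates for
    Player I applied to [- u] become estimates for Player II. *)
Lemma value_stepN (G u : 'rV[R]_n -> R) (N : R) :
  bounded_measurable u -> bounded_by N u ->
  (forall x, value_step p eps Omega G u x = u x) ->
  forall x, value_step p eps Omega (fun y => - G y) (fun y => - u y) x = - u x.
Proof.
move=> bu uN fu x; rewrite -[in RHS]fu /value_step; case: ifPn => // _.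
have bs := bounded_measurable_sup_inf x uN.
rewrite ball_averageN// (_ : sup_inf _ x = fun t => - sup_inf u x t);
  last first.
  apply/funext => t; rewrite /sup_inf !inf_imageE opprD opprK addrC.
  by under eq_fun do rewrite opprK.
have -> : step_average eps (fun t => - sup_inf u x t) =
    - step_average eps (sup_inf u x).
  exact: (averageN _ (lebesgue_measure_steps eps_gt0)).
by rewrite !mulrN -opprD.
Qed.

(** The hypothesis bears on the sum over the two players, who win the toss equally often. It covers
    a nearly maximizing Player I for [v = u] as well as a nearly minimizing Player II for [v = - u],
    the opponent's move being bounded by the infimum. *)
Lemma round_mean_near_optimal (S1 S2 : strategy n eps) (G v : 'rV[R]_n -> R)
    (N e : R) k (h : history R n k) :
  bounded_measurable v -> bounded_by N v -> 0 <= e ->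
  (forall x, value_step p eps Omega G v x = v x) ->
  (forall t, 0 < t <= eps ->
     sup_inf v (position h) t - e <= v (S1 k (h, t)) + v (S2 k (h, t))) ->
  v (position h) - e <= round_mean p Omega S1 S2 h (fun r => v r.2.2).
Proof.
move=> bv vN e0 fv opt; rewrite /round_mean; case: ifPn => [/asboolP Oh|_];
  last first.
  by rewrite gerBl.
have bplay (S : strategy n eps) := bounded_measurable_play S h bv.
have bs := bounded_measurable_sup_inf (position h) vN.
have be := @bounded_measurable_cst _ (measurableTypeR R) R (- e).
have : step_average eps (sup_inf v (position h)) - e <=
    step_average eps (fun t => v (S1 k (h, t))) +
    step_average eps (fun t => v (S2 k (h, t))).
  rewrite -[X in _ + X <= _](step_average_cst eps_gt0) -!step_averageD//.
  by apply: step_average_le => //; exact: bounded_measurableD.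
rewrite -{1}(fv (position h)) /value_step asboolT//.
have := alpha_gt0 n_gt0 p_gt2; have := beta_gt0 n_gt0 p_gt2.
have := alphaDbeta n_gt0 p_gt2.
set a := alpha n p; set b := beta n p => ab b0 a0.
set s := step_average _ (sup_inf _ _);
  set q1 := step_average _ (fun t => v (S1 _ _)).
set q2 := step_average _ (fun t => v (S2 _ _)).
set q := ball_average _ _ v => hs.
have h1 : a / 2 * (s - e) <= a / 2 * (q1 + q2) by apply: ler_wpM2l => //;
  rewrite divr_ge0// ltW.
(* The loss only occurs when the toss takes place, with weight at most 1. *)
have h2 : a / 2 * e <= e by nra.
by rewrite mulrBr mulrDr in h1; lra.
Qed.

Variables (F : 'rV[R]_n -> R) (M : R).
Hypotheses (bOmega : bounded_set Omega).
Hypothesis mF : measurable_fun setT (F \_ (Gamma_eps eps Omega)).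
Variable u : 'rV[R]_n -> R.
Hypotheses (mu : measurable_fun setT u) (uM : bounded_by M u).
Hypothesis fu :
  forall x, value_step p eps Omega (F \_ (Gamma_eps eps Omega)) u x = u x.

Let bu : bounded_measurable u.
Proof. by split => //; exists M. Qed.

Let uF x : ~ Omega x -> u x = (F \_ (Gamma_eps eps Omega)) x.
Proof. by move=> nO; rewrite -fu /value_step asboolF. Qed.

Let eta (d : R) (k : nat) : R := d / 2 ^+ k.+1.

Let eta_gt0 d k : 0 < d -> 0 < eta d k.
Proof. by move=> d0; rewrite divr_gt0// exprn_gt0. Qed.

Let sum_eta d k : 0 <= d -> \sum_(j < k) eta d j <= d.
Proof.
move=> d0; suff -> : \sum_(j < k) eta d j = d - d / 2 ^+ k.
  by rewrite gerBl divr_ge0// exprn_ge0.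
elim: k => [|k IHk]; first by rewrite big_ord0 expr0 divr1 subrr.
by rewrite big_ord_recr /= IHk /eta exprS; field; rewrite expf_neq0.
Qed.

Lemma value_I_ge x0 : Omega_eps eps Omega x0 ->
  ((u x0)%:E <= value_I p eps Omega F x0)%E.
Proof.
move=> x0O; apply/lee_addgt0Pr => d d0.
have [S1 S1P] := exists_near_optimal_strategy eps uM (fun k => eta_gt0 k d0).
rewrite -leeBlDr//.
apply: le_trans (_ : ereal_inf (range (fun S2 => expected_payoff p Omega F x0
  S1 S2)) <= _)%E; last first.
  by apply: ereal_sup_ubound; exists S1.
apply: le_ereal_inf_tmp => _ [S2 _ <-].
apply: (expected_payoff_ge n_gt0 p_gt2 eps_gt0 oOmega bOmega mF mu uM uF x0O
  (fun k => sum_eta k (ltW d0))) => k h.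
apply: (round_mean_near_optimal bu uM (ltW (eta_gt0 k d0)) fu) => t t0e.
have /andP[t0 _] := t0e; have h1 := S1P k h t t0.
have h2 : inf (u @` eball (position h) t) <= u (S2 k (h, t)).
  rewrite inf_imageE lerNl; apply: (le_sup_image (M := M)) => //.
    by move=> y; rewrite normrN.
  exact: next_position_eball.
by rewrite /sup_inf; lra.
Qed.

Lemma value_II_le x0 : Omega_eps eps Omega x0 ->
  (value_II p eps Omega F x0 <= (u x0)%:E)%E.
Proof.
move=> x0O; apply/lee_addgt0Pr => d d0.
have uM' : bounded_by M (fun x => - u x) by move=> x; rewrite normrN.
have [S2 S2P] := exists_near_optimal_strategy eps uM' (fun k => eta_gt0 k d0).
apply: le_trans (_ : _ <= ereal_sup (range (fun S1 => expected_payoff p Omega F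
  x0 S1 S2)))%E _.
  by apply: ereal_inf_lbound; exists S2.
apply: ge_ereal_sup => _ [S1 _ <-].
apply: (expected_payoff_le n_gt0 p_gt2 eps_gt0 oOmega bOmega mF mu uM uF x0O
  (fun k => sum_eta k (ltW d0))) => k h.
apply: (round_mean_near_optimal (bounded_measurableN bu) uM' (ltW (eta_gt0 k
  d0))
  (value_stepN bu uM fu)) => t t0e.
have /andP[t0 _] := t0e; have h1 := S2P k h t t0.
have h2 : inf ((fun y => - u y) @` eball (position h) t) <= - u (S1 k (h, t)).
  rewrite inf_imageE lerN2; under eq_fun do rewrite opprK.
  apply: (le_sup_image uM); exact: next_position_eball.
by rewrite /sup_inf; lra.
Qed.

End value.

Lemma value_I_le_value_II (R : realType) (n : nat) (p eps : R)
    (Omega : set 'rV[R]_n) (F : 'rV[R]_n -> R) x0 :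
  (value_I p eps Omega F x0 <= value_II p eps Omega F x0)%E.
Proof.
apply: ge_ereal_sup => _ [S1 _ <-]; apply: le_ereal_inf_tmp => _ [S2 _ <-].
apply: (@le_trans _ _ (expected_payoff p Omega F x0 S1 S2)).
  by apply: ereal_inf_lbound; exists S2.
by apply: ereal_sup_ubound; exists S1.
Qed.

Theorem lemma2p1 (R : realType) (n : nat) (p eps : R)
    (Omega : set 'rV[R]_n) (F : 'rV[R]_n -> R)
    (n_ge2 : (2 <= n)%N) (p_gt2 : 2 < p) (eps_itv : 0 < eps < 1)
    (domOmega : bounded_domain Omega)
    (extOmega : uniform_exterior_sphere Omega)
    (mF : measurable_fun (Gamma_eps eps Omega) F)
    (bF : [bounded F x | x in Gamma_eps eps Omega]) :
  exists u : 'rV[R]_n -> R,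
    [/\ (* u is the common value of both players *)
        forall x, Omega_eps eps Omega x ->
          (u x)%:E = value_I p eps Omega F x /\
          (u x)%:E = value_II p eps Omega F x,
        (* and it is determined on Omega_eps by this property *)
        forall v : 'rV[R]_n -> R,
          (forall x, Omega_eps eps Omega x ->
             (v x)%:E = value_I p eps Omega F x /\
             (v x)%:E = value_II p eps Omega F x) ->
          forall x, Omega_eps eps Omega x -> v x = u x,
        forall x, Gamma_eps eps Omega x -> u x = F x,
        (* so that the sup, inf and integrals below are genuine *)
        measurable_fun (Omega_eps eps Omega) u /\
        [bounded u x | x in Omega_eps eps Omega]
      & forall x, Omega x -> dpp p eps u x].
Proof.
have n_gt0 : (0 < n)%N by exact: leq_trans n_ge2.
have /andP[eps_gt0 _] := eps_itv.
have [_ oOmega _ bOmega] := domOmega.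
have mOmega := open_measurable_rV oOmega.
have mGamma := measurable_Gamma_eps eps oOmega.
pose G := F \_ (Gamma_eps eps Omega).
have mG : measurable_fun setT G := (measurable_restrictT F mGamma).1 mF.
have [M GM] : exists M, bounded_by M G.
  (* Boundedness provides a bound for each number greater than [N]; [|N| + 1] is one that is also
     nonnegative, as the zero values off [Gamma_eps] require. *)
  have [N [_ FN]] := bF; exists (`|N| + 1) => x; rewrite /G patchE.
  case: ifPn => [/set_mem Gx|_]; last by rewrite normr0 addr_ge0.
  by apply: FN Gx; rewrite ltr_pwDr// ler_norm.
have [u [mu uM fu]] :=
  exists_dpp_solution n_gt0 p_gt2 eps_gt0 mOmega bOmega mG GM.
have uI x : Omega_eps eps Omega x -> (u x)%:E = value_I p eps Omega F x.
  move=> Ox; apply/eqP; rewrite eq_le; apply/andP; split.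
    exact: (value_I_ge n_gt0 p_gt2 eps_gt0 oOmega bOmega mG mu uM fu Ox).
  apply: (le_trans (value_I_le_value_II _ _ _ _ _)).
  exact: (value_II_le n_gt0 p_gt2 eps_gt0 oOmega bOmega mG mu uM fu Ox).
have uII x : Omega_eps eps Omega x -> (u x)%:E = value_II p eps Omega F x.
  move=> Ox; apply/eqP; rewrite eq_le; apply/andP; split.
    by rewrite (uI x Ox); exact: value_I_le_value_II.
  exact: (value_II_le n_gt0 p_gt2 eps_gt0 oOmega bOmega mG mu uM fu Ox).
exists u; split.
- by move=> x Ox; split; [exact: uI|exact: uII].
- move=> v vP x Ox; apply: EFin_inj; rewrite (uI x Ox).
  exact: (vP x Ox).1.
- move=> x Gx; rewrite -fu /value_step asboolF; last by case: Gx.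
  by rewrite /G patchE mem_set.
- split; first exact: measurable_funTS.
  exists M; split; first exact: num_real.
  by move=> N MN x _; exact: le_trans (uM x) (ltW MN).
- move=> x Ox; exact (value_step_dpp eps_gt0 Ox (fu x)).
Qed.
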